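(* Let $\Lambda=\Lambda(\mu,\nu)=\{m\mu+n\nu: m,n\in\mathbf{Z}\}$ be a complex lattice with generators chosen such that $\tau=\nu/\mu$ lies in the fundamental region $-\frac12<\Re(\tau)\le\frac12$, $\Im(\tau)>0$, $|\tau|\ge1$, and $\Re(\tau)\ge0$ if $|\tau|=1$. Let $$D(\tau)=\{z\in\mathbf{C}:\ \Re(-1\pm z\pm\tau)<0,\ \Im(\tau\pm z)>0\}$$ (all choices of signs). Then for every $z\in D(\tau)$ with $z\ne0$, $$\wp(z,\tau)=\frac{1}{z^2}+8\int_0^\infty\lambda\left[e^{-\lambda}\sinh^2\left(\frac{z\lambda}{2}\right)f_1(\tau,\lambda)+e^{i\tau\lambda}\sin^2\left(\frac{z\lambda}{2}\right)f_2(\tau,\lambda)\right]d\lambda$$ and $$\zeta(z,\tau)=\frac1z+4\int_0^\infty\left[e^{-\lambda}\big(z\lambda-\sinh(z\lambda)\big)f_1(\tau,\lambda)-e^{i\tau\lambda}\big(z\lambda-\sin(z\lambda)\big)f_2(\tau,\lambda)\right]d\lambda,$$ where $$f_1(\tau,\lambda)=\frac{\cosh^2(\tau\lambda/2)}{1-2e^{-\lambda}\cosh(\tau\lambda)+e^{-2\lambda}},\qquad f_2(\tau,\lambda)=\frac{\cos^2(\lambda/2)}{1-2e^{i\tau\lambda}\cos(\lambda)+e^{2i\tau\lambda}}.$$ Moreover the homogeneous functions satisfy $\wp(x|\mu,\nu)=\mu^{-2}\wp(x/\mu,\tau)$ and $\zeta(x|\mu,\nu)=\mu^{-1}\zeta(x/\mu,\tau)$,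 so that whenever $z=x/\mu\in D(\tau)$, $z\neq 0$, $$\wp(x|\mu,\nu)=\frac{1}{\mu^2}\left(\frac{1}{z^2}+8\int_0^\infty\lambda\left[e^{-\lambda}\sinh^2\left(\frac{z\lambda}{2}\right)f_1(\tau,\lambda)+e^{i\tau\lambda}\sin^2\left(\frac{z\lambda}{2}\right)f_2(\tau,\lambda)\right]d\lambda\right)$$ and $$\zeta(x|\mu,\nu)=\frac{1}{\mu}\left(\frac1z+4\int_0^\infty\left[e^{-\lambda}\big(z\lambda-\sinh(z\lambda)\big)f_1(\tau,\lambda)-e^{i\tau\lambda}\big(z\lambda-\sin(z\lambda)\big)f_2(\tau,\lambda)\right]d\lambda\right).$$
   Context: For a lattice $\Lambda=\Lambda(\mu,\nu)$, the Weierstrass functions are $$\wp(x|\mu,\nu)=\frac1{x^2}+\sum_{\omega\in\Lambda\setminus\{0\}}\left(\frac1{(x-\omega)^2}-\frac1{\omega^2}\right),\qquad \zeta(x|\mu,\nu)=\frac1x+\sum_{\omega\in\Lambda\setminus\{0\}}\left(\frac1{x-\omega}+\frac1\omega+\frac{x}{\omega^2}\right).$$ The inhomogeneous functions are $\wp(z,\tau)=\wp(z|1,\tau)$ and $\zeta(z,\tau)=\zeta(z|1,\tau)$. *)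

(* Defs.v *)
From HB Require Import structures.
From mathcomp Require Import all_boot all_order all_algebra.
From mathcomp Require Import all_classical all_reals all_analysis.
From mathcomp Require Export complex.
From mathcomp.analysis.showcase Require summability.

Set Implicit Arguments.
Unset Strict Implicit.
Unset Printing Implicit Defensive.

Import Order.TTheory GRing.Theory Num.Theory.
Import numFieldNormedType.Exports.

Local Open Scope classical_set_scope.
Local Open Scope ring_scope.
Local Open Scope complex_scope.

Local Notation Re := complex.Re.
Local Notation Im := complex.Im.

Section ComplexFunctions.
Context {R : realType}.
Implicit Types z : R[i].

Definition expC z : R[i] := (expR (Re z))%:C * (cos (Im z) +i* sin (Im z)).
Definition coshC z : R[i] := (expC z + expC (- z)) / 2.
Definition sinhC z : R[i] := (expC z - expC (- z)) / 2.
Definition cosC z : R[i] := (expC ('i%C * z) + expC (- ('i%C * z))) / 2.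
Definition sinC z : R[i] := (expC ('i%C * z) - expC (- ('i%C * z))) / (2 * 'i%C).

End ComplexFunctions.

Section ComplexIntegral.
Context {R : realType}.
Implicit Types (D : set R) (f : R -> R[i]).

Definition integrableC D f : Prop :=
  (@lebesgue_measure R).-integrable D (fun t => (Re (f t))%:E) /\
  (@lebesgue_measure R).-integrable D (fun t => (Im (f t))%:E).

Definition integralC D f : R[i] :=
  (\int[@lebesgue_measure R]_(t in D) Re (f t)) +i*
  (\int[@lebesgue_measure R]_(t in D) Im (f t)).

End ComplexIntegral.

Section Weierstrass.
Context {R : realType}.
Implicit Types x z w mu nu tau : R[i].

(* Unordered sum over [D]: the limit of the sums over the finite subsets of
   [R[i]], directed by inclusion, the summand being extended by 0 outside [D].
   The summand is not indexed by the coordinates [(m, n)] of a lattice point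
   but by the point itself. *)
Definition sumC (D : set R[i]) (f : R[i] -> R[i]) : R[i] :=
  summability.sum (fun w : R[i] => (if w \in D then f w else 0) : R[i]^o).

Definition lattice mu nu : set R[i] :=
  [set w | exists m n : int, w = m%:~R * mu + n%:~R * nu].

Definition wp x mu nu : R[i] :=
  1 / x ^+ 2 +
  sumC (lattice mu nu `\ 0) (fun w => 1 / (x - w) ^+ 2 - 1 / w ^+ 2).

Definition wzeta x mu nu : R[i] :=
  1 / x +
  sumC (lattice mu nu `\ 0) (fun w => 1 / (x - w) + 1 / w + x / w ^+ 2).

Definition wp_inh z tau : R[i] := wp z 1 tau.
Definition wzeta_inh z tau : R[i] := wzeta z 1 tau.

Definition fundamental_region : set R[i] :=
  [set tau | [/\ - 2^-1 < Re tau <= 2^-1, 0 < Im tau, 1 <= `|tau|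
               & `|tau| = 1 -> 0 <= Re tau]].

Definition Ddomain tau : set R[i] :=
  [set z | [/\ Re (- 1 + z + tau) < 0, Re (- 1 + z - tau) < 0,
               Re (- 1 - z + tau) < 0 & Re (- 1 - z - tau) < 0] /\
           (0 < Im (tau + z) /\ 0 < Im (tau - z))].

(* The denominators of [f1] and [f2] vanish at [l = 0] and nowhere else on
   [0, +oo[ when [tau] is in the fundamental region; integrals are therefore
   taken over the open half-line. *)
Definition f1 tau (l : R) : R[i] :=
  coshC (tau * l%:C / 2) ^+ 2 /
  (1 - 2 * expC (- l%:C) * coshC (tau * l%:C) + expC (- (2 * l%:C))).

Definition f2 tau (l : R) : R[i] :=
  cosC (l%:C / 2) ^+ 2 /
  (1 - 2 * expC ('i%C * tau * l%:C) * cosC l%:C + expC (2 * 'i%C * tau * l%:C)).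

Definition wp_integrand z tau (l : R) : R[i] :=
  l%:C * (expC (- l%:C) * sinhC (z * l%:C / 2) ^+ 2 * f1 tau l +
          expC ('i%C * tau * l%:C) * sinC (z * l%:C / 2) ^+ 2 * f2 tau l).

Definition wzeta_integrand z tau (l : R) : R[i] :=
  expC (- l%:C) * (z * l%:C - sinhC (z * l%:C)) * f1 tau l -
  expC ('i%C * tau * l%:C) * (z * l%:C - sinC (z * l%:C)) * f2 tau l.

End Weierstrass.

(* Main.v *)
(* For [Re s > 0] the Laplace transforms of [1] and [l] are [1/s] and [1/s^2],
   so for [Re w > |Re z|] the summand [g z w] of either series is the integral of
   [phi z l * e^(-w l)], where [phi z l = O(l^2 e^(|Re z| l))]: it is
   [l (e^(z l) - 1)] for wp and [1 + z l - e^(z l)] for zeta.  Cut the lattice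
   along the diagonals [|m| = |n|] into four cones, a diagonal point counting for
   one half in each of its two cones.  On the cone [|n| <= m] the exponentials
   [e^(-(m mu + n nu) l)] sum to a rational function of [e^(-mu l)] and
   [e^(nu l)], which is [O(l^-2)] at 0, so sum and integral can be exchanged
   by dominated convergence.  As [g] is homogeneous in [(z, w)], multiplication
   by [-1], [-i] and [i] reduces the three other cones to this one; the cones
   around the real axis give [f1], those around [tau] give [f2]. *)

Require Import Defs.
From mathcomp Require Import all_boot all_order all_algebra finmap.
From mathcomp Require Import all_classical all_reals all_analysis.
From mathcomp Require Import measurable_realfun ring lra zify.
From mathcomp.analysis.showcase Require summability.

Set Implicit Arguments.
Unset Strict Implicit.
Unset Printing Implicit Defensive.

Import Order.TTheory GRing.Theory Num.Theory.
Import numFieldNormedType.Exports.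

Local Open Scope classical_set_scope.
Local Open Scope ring_scope.
Local Open Scope complex_scope.

Local Notation Re := complex.Re.
Local Notation Im := complex.Im.
Local Notation normc := Normc.normc.

(** * Complex numbers in coordinates *)

Section Complex.
Context {R : realType}.
Implicit Types (z w : R[i]) (x y l : R).

(** Where the domain comes from: on the cone [|n| <= m] one has
    [Re (m mu + n nu) >= m (Re mu - |Re nu|)], so all its Laplace integrals converge, with a common
    rate, once [|Re z| + |Re nu| < Re mu]. Around the real axis ([mu = 1], [nu = tau]) this reads
    [|Re z| + |Re tau| < 1]; around [tau], after a quarter turn ([mu = - i tau], [nu = - i]), it
    reads [|Im z| < Im tau]. Together these inequalities describe D(tau). Summing exponentials over
    a planar cone creates a double pole at [l = 0]; the subtracted terms of the two series are what
    makes [phi] vanish to second order there. The series are unordered sums, whereas the integrals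
    control sums over the boxes [|m|, |n| <= N]. The dominating function bounds the sum of the
    absolute values of the terms, so its integral also bounds the sums of [|g|] over boxes; given
    such a bound, the limit along the boxes is the unordered sum. *)

Lemma eq_ReIm z w : Re z = Re w -> Im z = Im w -> z = w.
Proof. by case: z => a b; case: w => c d /= -> ->. Qed.

Lemma cReD z w : Re (z + w) = Re z + Re w. Proof. by case: z; case: w. Qed.
Lemma cImD z w : Im (z + w) = Im z + Im w. Proof. by case: z; case: w. Qed.
Lemma cReN z : Re (- z) = - Re z. Proof. by case: z. Qed.
Lemma cImN z : Im (- z) = - Im z. Proof. by case: z. Qed.
Lemma cReM z w : Re (z * w) = Re z * Re w - Im z * Im w.
Proof. by case: z; case: w. Qed.
Lemma cImM z w : Im (z * w) = Re z * Im w + Im z * Re w.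
Proof. by case: z; case: w. Qed.
Lemma Re_real x : Re x%:C = x. Proof. by []. Qed.
Lemma Im_real x : Im x%:C = 0. Proof. by []. Qed.
Lemma Re_nat n : Re (n%:R : R[i]) = n%:R.
Proof. by elim: n => [|n ih] //; rewrite -addn1 !natrD cReD ih. Qed.
Lemma Im_nat n : Im (n%:R : R[i]) = 0.
Proof. by elim: n => [|n ih] //; rewrite -addn1 !natrD cImD ih addr0. Qed.
Lemma Re_int n : Re (n%:~R : R[i]) = n%:~R.
Proof. by case: n => n; rewrite ?NegzE ?mulrNz ?cReN -!pmulrn Re_nat. Qed.
Lemma Im_int n : Im (n%:~R : R[i]) = 0.
Proof. by case: n => n; rewrite ?NegzE ?mulrNz ?cImN -!pmulrn Im_nat ?oppr0. Qed.

Definition ReImE := (cReD, cImD, cReN, cImN, cReM, cImM, Re_real, Im_real, Re_int,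
  Im_int).

Lemma normcE z : normc z = Num.sqrt (Re z ^+ 2 + Im z ^+ 2).
Proof. by case: z. Qed.

Lemma normc_ge0 z : 0 <= normc z.
Proof. by rewrite normcE sqrtr_ge0. Qed.

Lemma normr_normc z : `|z| = (normc z)%:C.
Proof. by rewrite normcE normc_def. Qed.

Lemma normc_real x : normc x%:C = `|x|.
Proof. by rewrite normcE /= expr0n addr0 sqrtr_sqr. Qed.

Lemma ler_Re_normc z : `|Re z| <= normc z.
Proof.
rewrite normcE -(@ger0_norm _ (Num.sqrt _)) ?sqrtr_ge0// -ler_sqr ?nnegrE//.
by rewrite !real_normK ?num_real// sqr_sqrtr ?addr_ge0 ?sqr_ge0// lerDl sqr_ge0.
Qed.

Lemma ler_Im_normc z : `|Im z| <= normc z.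
Proof.
rewrite normcE -(@ger0_norm _ (Num.sqrt _)) ?sqrtr_ge0// -ler_sqr ?nnegrE//.
by rewrite !real_normK ?num_real// sqr_sqrtr ?addr_ge0 ?sqr_ge0// lerDr sqr_ge0.
Qed.

Lemma ler_normcReIm z : normc z <= `|Re z| + `|Im z|.
Proof.
rewrite normcE -[leRHS]ger0_norm ?addr_ge0// -sqrtr_sqr ler_sqrt ?sqr_ge0//.
rewrite sqrrD !real_normK ?num_real//.
by rewrite addrAC lerDl mulrn_wge0 ?mulr_ge0.
Qed.

Lemma ler_normc_sum (I : Type) (s : seq I) (F : I -> R[i]) :
  normc (\sum_(i <- s) F i) <= \sum_(i <- s) normc (F i).
Proof.
elim/big_ind2: _ => [|a b c d h h'|i _] //; first by rewrite Normc.normc0.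
by apply: le_trans (le_normcD _ _) _; apply: lerD.
Qed.

Lemma expC0 : expC (0 : R[i]) = 1.
Proof. by rewrite /expC /= expR0 mul1r cos0 sin0. Qed.

Lemma expCD z w : expC (z + w) = expC z * expC w.
Proof.
by apply: eq_ReIm; rewrite /expC !ReImE /= expRD (cosD, sinD); ring.
Qed.

Lemma expCV z : expC z * expC (- z) = 1.
Proof. by rewrite -expCD subrr expC0. Qed.

Lemma expC_neq0 z : expC z != 0.
Proof. by apply/eqP => h; have := expCV z; rewrite h mul0r => /esym/eqP; rewrite oner_eq0. Qed.

Lemma expCN z : expC (- z) = (expC z)^-1.
Proof. by apply: (mulfI (expC_neq0 z)); rewrite expCV mulfV ?expC_neq0. Qed.

Lemma expC_nat z n : expC (n%:R * z) = expC z ^+ n.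
Proof.
elim: n => [|n ih]; first by rewrite mul0r expC0 expr0.
by rewrite -addn1 natrD mulrDl mul1r expCD ih exprD expr1.
Qed.

Lemma expC_int z (n : int) : expC (n%:~R * z) = expC z ^ n.
Proof.
case: n => n; first exact: expC_nat.
by rewrite NegzE mulrNz mulNr expCN -pmulrn expC_nat -exprnN.
Qed.

Lemma normc_expC z : normc (expC z) = expR (Re z).
Proof.
rewrite Normc.normcM normc_real ger0_norm ?expR_ge0//=.
by rewrite cos2Dsin2 sqrtr1 mulr1.
Qed.

End Complex.


(** * Cones of lattice points *)

Section Boxes.

Fixpoint zbox (N : nat) : seq int :=
  if N is n.+1 then n.+1%:Z :: - n.+1%:Z :: zbox n else [:: 0].

Lemma mem_zbox N (m : int) : (m \in zbox N) = (`|m| <= N)%N.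
Proof.
elim: N => [|N ih] /=; first by rewrite inE; lia.
by rewrite !inE ih; lia.
Qed.

Lemma uniq_zbox N : uniq (zbox N).
Proof. by elim: N => // N ih /=; rewrite ih !inE !mem_zbox; lia. Qed.

(* Twice the weight of [(m, n)] in the cone [|n| <= m]: 2 inside, 1 on the diagonals
   and 0 elsewhere, in particular at the origin. *)
Definition cone_weight (m n : int) : nat :=
  ((- m <= n < m)%R + (- m < n <= m)%R)%N.

(** The four cones are exchanged by negation and by the swap of coordinates. The swap fixes the
    diagonal [m = n], so no half-open convention could count a diagonal point exactly once: equal
    halves are forced, and doubling keeps the weights in [nat]. *)
Lemma cone_weight_partition m n : (m != 0) || (n != 0) ->
  (cone_weight m n + cone_weight (- m) (- n) +
   (cone_weight n m + cone_weight (- n) (- m)))%N = 2.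
Proof. by rewrite /cone_weight; lia. Qed.

Lemma cone_weight_gt0 m n : (0 < cone_weight m n)%N -> (`|n| <= m)%R /\ (0 < m)%R.
Proof. by rewrite /cone_weight; lia. Qed.

Context {V : nmodType}.

Lemma big_zbox_opp N (u : int -> V) :
  \sum_(m <- zbox N) u (- m) = \sum_(m <- zbox N) u m.
Proof.
elim: N => [|N ih]; first by rewrite !big_seq1 oppr0.
by rewrite /= !big_cons ih opprK addrCA.
Qed.

(* The weighted sum over the slice [m = k + 1] of the cone; see [big_cone]. *)
Definition cone_slice (u : int -> V) (k : nat) : V :=
  (\sum_(n <- zbox k) u n) *+ 2 + (u k.+1 + u (- k.+1%:Z)).

Lemma big_cone_weight0 N (m : int) (u : int -> V) : (m <= 0)%R ->
  \sum_(n <- zbox N) u n *+ cone_weight m n = 0.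
Proof.
move=> m0; rewrite big1 // => n _.
suff -> : cone_weight m n = 0%N by rewrite mulr0n.
by rewrite /cone_weight; lia.
Qed.

Lemma big_cone_weight N k (u : int -> V) : (k < N)%N ->
  \sum_(n <- zbox N) u n *+ cone_weight k.+1 n = cone_slice u k.
Proof.
elim: N => // N ih; rewrite ltnS leq_eqVlt => /predU1P[->|kN].
  rewrite /= !big_cons addrA addrC; congr (_ + _).
    rewrite -sumrMnl big_seq [RHS]big_seq; apply: eq_bigr => n.
    rewrite mem_zbox => nN; suff -> : cone_weight N.+1 n = 2%N by [].
    by rewrite /cone_weight; lia.
  have -> : cone_weight N.+1 N.+1 = 1%N by rewrite /cone_weight; lia.
  by have -> : cone_weight N.+1 (- N.+1%:Z) = 1%N by rewrite /cone_weight; lia.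
rewrite /= !big_cons ih //.
have -> : cone_weight k.+1 N.+1 = 0%N by rewrite /cone_weight; lia.
have -> : cone_weight k.+1 (- N.+1%:Z) = 0%N by rewrite /cone_weight; lia.
by rewrite !mulr0n !add0r.
Qed.

Lemma big_cone N (u : int -> int -> V) :
  \sum_(m <- zbox N) \sum_(n <- zbox N) u m n *+ cone_weight m n =
  \sum_(k < N) cone_slice (u k.+1) k.
Proof.
have -> : forall f : int -> V, (forall m, (m <= 0)%R -> f m = 0) ->
    \sum_(m <- zbox N) f m = \sum_(k < N) f k.+1.
  move=> f f0; elim: N {u} => [|N ih]; first by rewrite big_seq1 big_ord0 f0.
  rewrite /= !big_cons ih big_ord_recr/= (f0 (- _)) ?add0r 1?addrC//.
by apply: eq_bigr => k _; rewrite big_cone_weight.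
by move=> m m0; rewrite big_cone_weight0.
Qed.

End Boxes.

(** * Generating function of the cone slices *)

Section ConeSeries.
Context {F : fieldType}.
Variables (q a : F).
Hypothesis a0 : a != 0.

Local Notation t := (cone_slice (fun n => a ^ n)).

Let s n := a ^+ n + a ^- n.

Let s_rec n : s n.+2 + s n = (a + a^-1) * s n.+1.
Proof.
rewrite /s -!exprVn !exprS; have := mulfV a0; set b := a^-1 => h.
by ring: h.
Qed.

Let cone_slice0 : t 0 = s 1 + s 0.
Proof.
rewrite /cone_slice big_seq1 /s.
have -> : a ^ (- 1%:Z) = a ^- 1 by [].
have -> : a ^ 1%:Z = a ^+ 1 by [].
have -> : a ^ 0 = 1 by [].
by rewrite expr0 invr1; ring.
Qed.

Let cone_sliceS k : t k.+1 = t k + (s k.+1 + s k.+2).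
Proof.
rewrite /cone_slice /= !big_cons /s.
have E n : a ^ (- n.+1%:Z) = a ^- n.+1 by [].
have E' n : a ^ n.+1%:Z = a ^+ n.+1 by [].
rewrite !E !E'; ring.
Qed.

(** The recurrence with characteristic roots [a] and [a^-1] is inherited from [s]. It replaces the
    closed form of a slice, which divides by [a - 1], whereas [a = 1] does occur later ([nu = - i],
    [l = 2 pi]). *)
Lemma cone_slice_rec k : t k.+2 + t k = (a + a^-1) * t k.+1.
Proof.
elim: k => [|k ih]; last first.
  transitivity ((t k.+2 + t k) + (s k.+3 + s k.+1) + (s k.+4 + s k.+2)).
    by rewrite (cone_sliceS k.+2) (cone_sliceS k); ring.
  by rewrite ih !s_rec -!mulrDr -addrA -cone_sliceS.
have h0 : (a + a^-1) * s 0 = 2 * s 1 by rewrite /s expr0 invr1 !expr1; ring.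
transitivity (2 * s 1 + (s 2 + s 0) *+ 2 + (s 3 + s 1)).
  by rewrite !cone_sliceS cone_slice0; ring.
by rewrite !s_rec -h0 -mulrnAr -!mulrDr cone_sliceS cone_slice0; congr (_ * _); ring.
Qed.

(** The factor on the left is the reversed characteristic polynomial of [cone_slice_rec], so the
    product telescopes; the last two terms are the remainder of the series. *)
Lemma cone_series N :
  (1 - q * (a + a^-1) + q ^+ 2) * \sum_(k < N.+1) q ^+ k.+1 * t k =
  q * (a + 2 + a^-1) - q ^+ N.+2 * t N.+1 + q ^+ N.+3 * t N.
Proof.
elim: N => [|N ih].
  rewrite big_ord_recl big_ord0 /= cone_sliceS cone_slice0 addr0.
  have h : s 2 = (a + a^-1) * s 1 - s 0 by rewrite -s_rec addrK.
  rewrite h /s expr0 invr1 !expr1; ring.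
have h : t N.+2 = (a + a^-1) * t N.+1 - t N by rewrite -cone_slice_rec addrK.
by rewrite big_ord_recr/= mulrDr ih h !exprS; ring.
Qed.

End ConeSeries.


#[local] Existing Instance summability.totally_filter.

(** * Unordered sums *)

Section UnorderedSums.
Context {R : realType}.

(** Expressed by a real sequence, so that squeeze arguments and limits of coordinates stay in
    [R]. *)
Definition cvgC (u : nat -> R[i]) (l : R[i]) : Prop :=
  normc (u n - l) @[n --> \oo] --> (0 : R).

Lemma partial_sumE (I : choiceType) (V : zmodType) (g : I -> V) (A : {fset I}) :
  summability.partial_sum g A = \sum_(w <- A) g w.
Proof. by rewrite big_seq_fsetE. Qed.

Lemma fset_sum_setU (I : choiceType) (V : nmodType) (A B : {fset I}) (F : I -> V) :
  \sum_(w <- (A `|` B)%fset) F w = \sum_(w <- A) F w + \sum_(w <- (B `\` A)%fset) F w.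
Proof.
rewrite (big_fsetID _ (mem A))/=; congr (_ + _); apply: eq_fbigl => w;
  by rewrite !inE; case: (w \in A); rewrite ?andbF ?orbT ?andbT.
Qed.

(** Every finite set meets the support of [g] inside some [B N], so [K] bounds all finite sums of
    norms and their supremum is finite. A finite set whose sum is close to the supremum leaves
    almost nothing outside it, and [S] is then compared with the sum over any larger set through
    [B N]. *)
Lemma sum_exhaustion (I : choiceType) (g : I -> R[i]) (B : nat -> {fset I})
    (S : R[i]) (K : R) :
  (forall w, g w != 0 -> exists N0, forall N, (N0 <= N)%N -> w \in B N) ->
  (forall N, \sum_(w <- B N) normc (g w) <= K) ->
  cvgC (fun N => \sum_(w <- B N) g w) S ->
  summability.sum (g : I -> R[i]^o) = S.
Proof.
move=> gB BK BS.
have supp (A : {fset I}) :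
    exists N0, forall N, (N0 <= N)%N -> forall w, w \in A -> g w != 0 -> w \in B N.
  elim/finSet_rect: A => A ihA.
  have [->|[x xA]] := fset_0Vmem A; first by exists 0%N => N _ w; rewrite inE.
  have [N1 H1] := ihA (A `\ x)%fset (fproperD1 xA).
  have [N2 H2] : exists N0, forall N, (N0 <= N)%N -> g x != 0 -> x \in B N.
    have [gx0|/gB[N2 H2]] := eqVneq (g x) 0; first by exists 0%N.
    by exists N2 => N /H2.
  exists (maxn N1 N2) => N; rewrite geq_max => /andP[N1N N2N] w wA.
  have [->|wx] := eqVneq w x; first exact: H2.
  by apply: H1 => //; rewrite !inE wx.
have sumU (V : nmodType) (F : I -> V) (A : {fset I}) N :
    (forall w, g w = 0 -> F w = 0) ->
    (forall w, w \in A -> g w != 0 -> w \in B N) ->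
    \sum_(w <- B N) F w = \sum_(w <- A) F w + \sum_(w <- (B N `\` A)%fset) F w.
  move=> F0 AB; rewrite -fset_sum_setU; apply: big_fset_incl.
    by apply/fsubsetP => w wB; rewrite inE wB orbT.
  move=> w; rewrite inE => /orP[wA|->//] wB; apply: F0; apply/eqP.
  by apply: contraNT wB; exact: AB.
have n0 w : g w = 0 -> normc (g w) = 0 by move=> ->; rewrite Normc.normc0.
pose E := [set \sum_(w <- A) normc (g w) | A in [set: {fset I}]].
have EK (A : {fset I}) : \sum_(w <- A) normc (g w) <= K.
  have [N /(_ _ (leqnn N)) AB] := supp A.
  rewrite (le_trans _ (BK N))// (sumU _ _ A)// lerDl.
  by apply: sumr_ge0 => w _; exact: normc_ge0.
have supE : has_sup E.
  split; first by exists (\sum_(w <- fset0) normc (g w)), fset0.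
  by exists K => _ [A _ <-].
apply: cvg_lim; first exact: norm_hausdorff.
apply/cvgrPdist_le => e e0.
have [e1 [e1_gt0 ->]] : exists e1 : R, 0 < e1 /\ e = e1%:C.
  move: e0; rewrite ltcE => /andP[/eqP e0 e1]; exists (Re e); split=> //.
  exact: eq_ReIm.
(* Norms summed over a finite set disjoint from some [A] containing [A0] now total at most [e1 / 2].
   This is applied to the complement of [A] in [B N]; the further error [d], from the limit along
   [B], is arbitrary. *)
have [_ [A0 _ <-] A0e] := sup_adherent (divr_gt0 e1_gt0 (ltr0Sn _ 1)) supE.
exists A0 => // A /= A0A.
rewrite normr_normc lecR partial_sumE.
have [N0 AB] := supp A.
suff : forall d, 0 < d -> normc (S - \sum_(w <- A) g w) <= e1 / 2 + d.
  by move=> /(_ (e1 / 2) (divr_gt0 e1_gt0 (ltr0Sn _ 1))); rewrite -splitr.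
move=> d d0.
have /cvgrPdist_lt/(_ _ d0)[N1 _ BSN] := BS.
pose N := maxn N0 N1.
have := BSN N (leq_maxr _ _); rewrite /= sub0r normrN ger0_norm ?normc_ge0// => SN.
have -> : S - \sum_(w <- A) g w =
    \sum_(w <- (B N `\` A)%fset) g w - (\sum_(w <- B N) g w - S).
  by rewrite (sumU _ _ A)//; [ring|exact: AB (leq_maxl _ _)].
apply: (le_trans (le_normcD _ _)); rewrite normcN; apply: lerD; last exact: ltW.
apply: (le_trans (ler_normc_sum _ _)).
have : \sum_(w <- (A `|` B N)%fset) normc (g w) <= sup E.
  by apply: sup_upper_bound => //; exists (A `|` B N)%fset.
rewrite fset_sum_setU.
have : \sum_(w <- A0) normc (g w) <= \sum_(w <- A) normc (g w).
  have /fsetUidPr <- := A0A; rewrite fset_sum_setU lerDl.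
  by apply: sumr_ge0 => w _; exact: normc_ge0.
by move: A0e; lra.
Qed.

(* Convergence is not needed: [lim] of a divergent filter is [0]. *)
Lemma sum_scale (c mu : R[i]) (f f' : R[i] -> R[i]) : c != 0 -> mu != 0 ->
  (forall w, f (mu * w) = c * f' w) ->
  summability.sum (f : R[i] -> R[i]^o) = c * summability.sum (f' : R[i] -> R[i]^o).
Proof.
move=> c0 mu0 ff'; rewrite /summability.sum.
pose ps g A := summability.partial_sum (g : R[i] -> R[i]^o) A.
have psE A : ps f [fset mu * w | w in A]%fset = c * ps f' A.
  rewrite /ps !partial_sumE big_imfset/=; last first.
    by move=> x y _ _; exact: mulfI.
  by rewrite mulr_sumr; apply: eq_bigr => w _.
have imK (x : R[i]) A : x != 0 ->
    [fset x * w | w in [fset x^-1 * w | w in A]]%fset = A.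
  move=> x0; apply/fsetP => w; apply/imfsetP/idP => /=.
    by move=> [_ /imfsetP[/= v vA ->] ->]; rewrite mulVKf.
  move=> wA; exists (x^-1 * w); rewrite ?mulVKf//.
  by apply/imfsetP; exists w.
have imS (x : R[i]) (A B : {fset R[i]}) : (A `<=` B)%fset ->
    ([fset x * w | w in A] `<=` [fset x * w | w in B])%fset.
  by move=> AB; apply: subset_imfset => w /=; exact: (fsubsetP AB).
(* Multiplication by [mu] is an automorphism of the inclusion order on finite sets, so it preserves
   the filter [totally]. An equality of filters transfers divergence as well as limits. *)
have fE : ps f @ summability.totally =
    (fun z : R[i]^o => c * z : R[i]^o) @ (ps f' @ summability.totally).
  apply/seteqP; split => P /= [A0 _ PA0].
    exists [fset mu^-1 * w | w in A0]%fset => // A A0A /=.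
    rewrite -psE; apply: PA0 => /=.
    by rewrite -(imK mu A0)//; exact: imS.
  exists [fset mu * w | w in A0]%fset => // A A0A /=.
  rewrite -(imK mu A)// psE; apply: PA0 => /=.
  have <- := imK mu^-1 A0 _; last by rewrite invr_eq0.
  by rewrite invrK; exact: imS.
have FF := @summability.totally_filter R[i].
rewrite -/(ps f) -/(ps f') [in LHS]fE.
have [Gc|Gd] := pselect (cvg (ps f' @ summability.totally)).
  by apply: cvg_lim; [exact: norm_hausdorff|apply: cvgMr].
have Gd' : ~ cvg ((fun z : R[i]^o => c * z : R[i]^o) @ (ps f' @ summability.totally)).
  move=> Gc; apply: Gd.
  have -> : ps f' @ summability.totally = (fun z : R[i]^o => c^-1 * z : R[i]^o) @
     ((fun z : R[i]^o => c * z : R[i]^o) @ (ps f' @ summability.totally)).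
    by apply/seteqP; split=> P /= [A0 _ PA0]; exists A0 => // A /PA0 /=; rewrite mulKf.
  by apply: is_cvgMr.
rewrite (dvgP Gd) (dvgP Gd').
have -> : (point : R[i]^o) = 0 by exact: erefl.
by rewrite mulr0.
Qed.

End UnorderedSums.


(** * Integration on the half-line *)

Section RealHalfLine.
Context {R : realType}.
Implicit Types (f F : R -> R) (k C : R).
Local Notation leb := (@lebesgue_measure R).
Local Notation D := (`]0, +oo[%classic : set R).

Lemma derive_addr f g (x a b : R) : is_derive x (1 : R) f a -> is_derive x (1 : R) g b ->
  is_derive x (1 : R) (fun t => f t + g t) (a + b).
Proof. by move=> df dg; exact: is_deriveD. Qed.

Lemma derive_mulr f g (x a b : R) : is_derive x (1 : R) f a -> is_derive x (1 : R) g b ->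
  is_derive x (1 : R) (fun t => f t * g t) (f x * b + g x * a).
Proof. by move=> df dg; exact: is_deriveM. Qed.

Lemma derive_scaler f (c x a : R) : is_derive x (1 : R) f a ->
  is_derive x (1 : R) (fun t => c * f t) (c * a).
Proof. by move=> df; exact: is_deriveZ. Qed.

Lemma derive_comp_scale f (c x a : R) : is_derive (c * x) (1 : R) f a ->
  is_derive x (1 : R) (fun t => f (c * t)) (c * a).
Proof.
move=> df; rewrite mulrC; apply: (is_derive1_comp (f := f)).
by rewrite -[X in is_derive _ _ _ X]mulr1; apply: derive_scaler; exact: is_derive_id.
Qed.

Lemma expR_decay_derive k x : is_derive x (1 : R) (fun t => expR (- k * t)) (- k * expR (- k * x)).
Proof. exact: derive_comp_scale. Qed.

Lemma derive_continuous f f' : (forall x, is_derive x (1 : R) f (f' x)) -> continuous f.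
Proof.
move=> h x; apply: differentiable_continuous; apply/derivable1_diffP.
by have [] := h x.
Qed.

Lemma expR_decay_cvg k : 0 < k -> expR (- k * x) @[x --> +oo] --> (0 : R).
Proof.
move=> k0.
have : (k * x) @[x --> +oo] --> +oo by exact: gt0_cvgMry.
move=> h; have := cvg_comp _ _ h (@cvgr_expR R).
by apply: cvg_trans; apply: near_eq_cvg; near=> x; rewrite /= mulNr.
Unshelve. all: by end_near. Qed.

Lemma ge0_FTC f F l : (forall x, is_derive x (1 : R) F (f x)) -> continuous f ->
  (forall x, 0 <= x -> 0 <= f x) -> F x @[x --> +oo] --> l ->
  leb.-integrable D (EFin \o f) /\ \int[leb]_(x in D) f x = l - F 0.
Proof.
move=> dF cf f0 Fl.
have mf : measurable_fun D f by apply: measurable_funTS; exact: continuous_measurable_fun.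
have E : (\int[leb]_(x in D) (f x)%:E = (l - F 0)%:E)%E.
  rewrite (integral_itv_obnd_cbnd (r := 0)); last exact/measurable_EFinP.
  apply: ge0_continuous_FTC2y => //.
  - exact: continuous_subspaceT.
  - apply: cvg_at_right_filter; exact: (derive_continuous dF).
  - by move=> x _; rewrite derive1E; have [_ ->] := dF x.
split; last by rewrite /Rintegral E.
apply/integrableP; split; first exact/measurable_EFinP.
have -> : (\int[leb]_(x in D) `|(f x)%:E| = \int[leb]_(x in D) (f x)%:E)%E.
  apply: eq_integral => x; rewrite inE/= in_itv/= andbT => x0.
  by rewrite ger0_norm ?f0 ?ltW.
by rewrite E ltry.
Qed.

Lemma expR_decay_integrable k C : 0 < k ->
  leb.-integrable D (fun x => (C * expR (- k * x))%:E).
Proof.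
move=> k0.
have [] := @ge0_FTC (fun x => expR (- k * x)) (fun x => - k^-1 * expR (- k * x)) (- k^-1 * 0).
- move=> x; have h := derive_scaler (- k^-1) (expR_decay_derive k x).
  by apply: (is_derive_eq h); rewrite mulrA mulrNN mulVf ?mul1r// gt_eqF.
- by apply: derive_continuous => x; exact: expR_decay_derive.
- by move=> x _; exact: expR_ge0.
- by apply: cvgMr; exact: expR_decay_cvg.
move=> h _; have := @integrableZl _ _ _ leb D _ C _ h.
by move=> /(_ (measurable_itv _)); apply: eq_integrable.
Qed.

Lemma dominated_integrable f k C : 0 < k -> measurable_fun D f ->
  (forall x, 0 < x -> `|f x| <= C * expR (- k * x)) ->
  leb.-integrable D (EFin \o f).
Proof.
move=> k0 mf fC; apply: le_integrable (expR_decay_integrable C k0) => //.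
  exact/measurable_EFinP.
move=> x /=; rewrite in_itv/= andbT => x0.
by rewrite lee_fin (le_trans (fC _ x0))// ler_norm.
Qed.

(* Adding the dominating exponential to [f] reduces this to the nonnegative case. *)
Lemma dominated_FTC f F l k C : 0 < k ->
  (forall x, is_derive x (1 : R) F (f x)) -> continuous f ->
  (forall x, 0 <= x -> `|f x| <= C * expR (- k * x)) -> F x @[x --> +oo] --> l ->
  \int[leb]_(x in D) f x = l - F 0.
Proof.
move=> k0 dF cf fC Fl.
pose e x := C * expR (- k * x); pose E x := - (C / k) * expR (- k * x).
have de x : is_derive x (1 : R) E (e x).
  have h := derive_scaler (- (C / k)) (expR_decay_derive k x).
  by apply: (is_derive_eq h); rewrite /e mulrA mulrNN divfK// gt_eqF.
have ce : continuous e.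
  by move=> x; apply: cvgMr; exact: (derive_continuous (expR_decay_derive k)).
have El : E x @[x --> +oo] --> - (C / k) * 0 by apply: cvgMr; exact: expR_decay_cvg.
have ie := expR_decay_integrable C k0.
have mf : measurable_fun D f by apply: measurable_funTS; exact: continuous_measurable_fun.
have if_ : leb.-integrable D (EFin \o f).
  by apply: (dominated_integrable k0 mf) => x /ltW; exact: fC.
have [_ h1] := @ge0_FTC (fun x => f x + e x) (fun x => F x + E x) (l + - (C / k) * 0)
  (fun x => is_deriveD (dF x) (de x)) (fun x => cvgD (cf x) (ce x))
  (fun x x0 => ltac:(have := fC x x0; rewrite ler_norml /e; lra)) (cvgD Fl El).
have [_ h2] := @ge0_FTC e E (- (C / k) * 0) de ce
  (fun x x0 => le_trans (normr_ge0 _) (fC x x0)) El.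
move: h1; rewrite RintegralD// h2 => h1.
by apply: (addIr (- (C / k) * 0 - E 0)); rewrite h1; ring.
Qed.

Lemma dominated_Rintegral_cvg (u : nat -> R -> R) f k C : 0 < k ->
  (forall n, measurable_fun D (u n)) ->
  (forall n x, 0 < x -> `|u n x| <= C * expR (- k * x)) ->
  (forall x, 0 < x -> u n x @[n --> \oo] --> f x) ->
  leb.-integrable D (EFin \o f) /\
  \int[leb]_(x in D) u n x @[n --> \oo] --> \int[leb]_(x in D) f x.
Proof.
move=> k0 mu uC uf.
have mf : measurable_fun D f.
  apply: (@measurable_fun_cvg _ _ _ D u) => // x.
  by rewrite /= in_itv/= andbT; exact: uf.
have [||||||if_ _ cv] := @dominated_convergence _ _ _ leb D _
  (fun n x => (u n x)%:E) (EFin \o f) (fun x => (C * expR (- k * x))%:E).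
- by [].
- by move=> n; apply/measurable_EFinP; exact: mu.
- by apply/measurable_EFinP; exact: mf.
- apply: aeW => x; rewrite /= in_itv/= andbT => x0; apply: cvg_EFin; last exact: uf.
  exact: nearW.
- exact: expR_decay_integrable.
- by apply: aeW => x n; rewrite /= in_itv/= andbT => x0; rewrite lee_fin; exact: uC.
split => //.
have := fine_cvg _; apply.
rewrite fineK; first exact: cv.
exact: integrable_fin_num.
Qed.

End RealHalfLine.


(** * Complex-valued functions on the half-line, by coordinates *)

Section ComplexHalfLine.
Context {R : realType}.
Implicit Types (f g F : R -> R[i]) (k C : R) (s z w : R[i]).
Local Notation leb := (@lebesgue_measure R).
Local Notation D := (`]0, +oo[%classic : set R).

Definition ccont f : Prop :=
  continuous (fun x => Re (f x)) /\ continuous (fun x => Im (f x)).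

Definition cderiv F f : Prop :=
  (forall x, is_derive x (1 : R) (fun t => Re (F t)) (Re (f x))) /\
  (forall x, is_derive x (1 : R) (fun t => Im (F t)) (Im (f x))).

Lemma cderiv_ccont F f : cderiv F f -> ccont F.
Proof. by move=> [d1 d2]; split; [exact: derive_continuous d1|exact: derive_continuous d2]. Qed.

Lemma cderiv_eq F f g : cderiv F f -> f =1 g -> cderiv F g.
Proof. by move=> [d1 d2] fg; split=> x; rewrite -fg. Qed.

Lemma cderiv_cst s : cderiv (fun=> s) (fun=> 0).
Proof. by split=> x; exact: is_derive_cst. Qed.

Lemma cderiv_id : cderiv (fun x => x%:C) (fun=> 1).
Proof. by split=> x /=; [exact: is_derive_id|exact: is_derive_cst]. Qed.

Lemma cderivM F G f g : cderiv F f -> cderiv G g ->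
  cderiv (fun x => F x * G x) (fun x => f x * G x + F x * g x).
Proof.
move=> [f1 f2] [g1 g2]; split => x.
  have h := derive_addr (derive_mulr (f1 x) (g1 x))
              (derive_scaler (-1) (derive_mulr (f2 x) (g2 x))).
  have -> : (fun t => Re (F t * G t)) =
    (fun t => Re (F t) * Re (G t) + -1 * (Im (F t) * Im (G t))).
    by apply/funext => t; rewrite cReM mulN1r.
  by apply: (is_derive_eq h); rewrite !ReImE; ring.
have h := derive_addr (derive_mulr (f1 x) (g2 x)) (derive_mulr (f2 x) (g1 x)).
have -> : (fun t => Im (F t * G t)) =
    (fun t => Re (F t) * Im (G t) + (Im (F t) * Re (G t))).
  by apply/funext => t; rewrite cImM.
by apply: (is_derive_eq h); rewrite !ReImE; ring.
Qed.

Lemma cderivD F G f g : cderiv F f -> cderiv G g ->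
  cderiv (fun x => F x + G x) (fun x => f x + g x).
Proof.
move=> [f1 f2] [g1 g2]; split => x.
  under eq_fun do rewrite cReD.
  by rewrite cReD; exact: derive_addr.
under eq_fun do rewrite cImD.
by rewrite cImD; exact: derive_addr.
Qed.

Lemma cderiv_expC s : cderiv (fun x => expC (s * x%:C)) (fun x => s * expC (s * x%:C)).
Proof.
have E x : Re (s * x%:C) = Re s * x by rewrite !ReImE mulr0 subr0.
have E' x : Im (s * x%:C) = Im s * x by rewrite !ReImE mulr0 add0r.
have dE x : is_derive x (1 : R) (fun t => expR (Re s * t)) (Re s * expR (Re s * x)).
  exact: derive_comp_scale.
have dC x : is_derive x (1 : R) (fun t => cos (Im s * t)) (Im s * - sin (Im s * x)).
  exact: derive_comp_scale.
have dS x : is_derive x (1 : R) (fun t => sin (Im s * t)) (Im s * cos (Im s * x)).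
  exact: derive_comp_scale.
have reE x : Re (expC (s * x%:C)) = expR (Re s * x) * cos (Im s * x).
  by rewrite /expC E E' cReM /= mul0r subr0.
have imE x : Im (expC (s * x%:C)) = expR (Re s * x) * sin (Im s * x).
  by rewrite /expC E E' cImM /= mul0r addr0.
split => x.
  under eq_fun do rewrite reE.
  apply: (is_derive_eq (derive_mulr (dE x) (dC x))).
  by rewrite cReM reE imE; ring.
under eq_fun do rewrite imE.
apply: (is_derive_eq (derive_mulr (dE x) (dS x))).
by rewrite cImM reE imE; ring.
Qed.

Lemma ccont_cst s : ccont (fun=> s). Proof. exact: cderiv_ccont (cderiv_cst s). Qed.
Lemma ccont_id : ccont (fun x => x%:C). Proof. exact: cderiv_ccont cderiv_id. Qed.
Lemma ccont_expC s : ccont (fun x => expC (s * x%:C)).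
Proof. exact: cderiv_ccont (cderiv_expC s). Qed.

Lemma ccontD f g : ccont f -> ccont g -> ccont (fun x => f x + g x).
Proof.
move=> [f1 f2] [g1 g2]; split => x.
  by under eq_fun do rewrite cReD; exact: cvgD (f1 x) (g1 x).
by under eq_fun do rewrite cImD; exact: cvgD (f2 x) (g2 x).
Qed.

Lemma ccontM f g : ccont f -> ccont g -> ccont (fun x => f x * g x).
Proof.
move=> [f1 f2] [g1 g2]; split => x.
  under eq_fun do rewrite cReM.
  exact: cvgB (cvgM (f1 x) (g1 x)) (cvgM (f2 x) (g2 x)).
under eq_fun do rewrite cImM.
exact: cvgD (cvgM (f1 x) (g2 x)) (cvgM (f2 x) (g1 x)).
Qed.

Lemma ccont_sum (I : Type) (r : seq I) (f : I -> R -> R[i]) :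
  (forall i, ccont (f i)) -> ccont (fun x => \sum_(i <- r) f i x).
Proof.
move=> cf; elim: r => [|i r ih].
  by under eq_fun do rewrite big_nil; exact: ccont_cst.
by under eq_fun do rewrite big_cons; exact: ccontD.
Qed.

Lemma eq_integrableC f g : (forall x, 0 < x -> f x = g x) ->
  integrableC D f -> integrableC D g.
Proof.
by move=> fg [i1 i2]; split; [apply: eq_integrable i1|apply: eq_integrable i2] => // x;
  rewrite inE /= in_itv/= andbT => x0; rewrite fg.
Qed.

Lemma eq_integralC f g : (forall x, 0 < x -> f x = g x) ->
  integralC D f = integralC D g.
Proof.
move=> fg; apply: eq_ReIm => /=; apply: eq_Rintegral => x;
  by rewrite inE /= in_itv/= andbT => x0; rewrite fg.
Qed.

Lemma integrableC_dom f k C : 0 < k -> ccont f ->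
  (forall x, 0 < x -> normc (f x) <= C * expR (- k * x)) -> integrableC D f.
Proof.
move=> k0 [c1 c2] fC; split; apply: (dominated_integrable (C := C) k0).
- by apply: measurable_funTS; exact: continuous_measurable_fun.
- by move=> x x0; rewrite (le_trans (ler_Re_normc _))// fC.
- by apply: measurable_funTS; exact: continuous_measurable_fun.
- by move=> x x0; rewrite (le_trans (ler_Im_normc _))// fC.
Qed.

Lemma integrable_scale (c : R) (h : R -> R) : leb.-integrable D (EFin \o h) ->
  leb.-integrable D (EFin \o (fun x => c * h x)).
Proof.
move=> ih; have := @integrableZl _ _ _ leb D _ c _ ih.
by move=> /(_ (measurable_itv _)); apply: eq_integrable.
Qed.

Lemma integrableCD f g : integrableC D f -> integrableC D g ->
  integrableC D (fun x => f x + g x).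
Proof.
move=> [f1 f2] [g1 g2]; split.
  by apply: eq_integrable (integrableD _ f1 g1) => // x _; rewrite /= cReD EFinD.
by apply: eq_integrable (integrableD _ f2 g2) => // x _; rewrite /= cImD EFinD.
Qed.

Lemma integralCD f g : integrableC D f -> integrableC D g ->
  integralC D (fun x => f x + g x) = integralC D f + integralC D g.
Proof.
move=> [f1 f2] [g1 g2]; apply: eq_ReIm => /=.
  by under eq_Rintegral do rewrite cReD; rewrite RintegralD.
by under eq_Rintegral do rewrite cImD; rewrite RintegralD.
Qed.

Lemma integrableCZ s f : integrableC D f -> integrableC D (fun x => s * f x).
Proof.
move=> [f1 f2]; split.
  have h := integrableB _ (integrable_scale (Re s) f1) (integrable_scale (Im s) f2).
  by apply: eq_integrable (h _) => // x _; rewrite /= cReM.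
have h := integrableD _ (integrable_scale (Re s) f2) (integrable_scale (Im s) f1).
by apply: eq_integrable (h _) => // x _; rewrite /= cImM.
Qed.

Lemma integralCZ s f : integrableC D f ->
  integralC D (fun x => s * f x) = s * integralC D f.
Proof.
move=> [f1 f2]; apply: eq_ReIm.
  rewrite cReM /=; under eq_Rintegral do rewrite cReM.
  by rewrite RintegralB// ?RintegralZl//; exact: integrable_scale.
rewrite cImM /=; under eq_Rintegral do rewrite cImM.
by rewrite RintegralD// ?RintegralZl//; exact: integrable_scale.
Qed.

Lemma integralC0 : integralC D (fun=> 0) = 0 :> R[i].
Proof. by apply: eq_ReIm; rewrite /= Rintegral_cst // mul0r. Qed.

Lemma integrableC0 : integrableC D (fun=> 0 : R[i]).
Proof. by split; exact: integrable0. Qed.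

Lemma integrableC_sum (I : Type) (r : seq I) (f : I -> R -> R[i]) :
  (forall i, integrableC D (f i)) ->
  integrableC D (fun x => \sum_(i <- r) f i x) /\
  integralC D (fun x => \sum_(i <- r) f i x) = \sum_(i <- r) integralC D (f i).
Proof.
move=> fi; elim: r => [|i r [ih1 ih2]].
  have -> : (fun x => \sum_(i <- [::]) f i x) = (fun=> 0).
    by apply/funext => x; rewrite big_nil.
  by rewrite big_nil integralC0; split => //; exact: integrableC0.
have -> : (fun x => \sum_(j <- i :: r) f j x) = (fun x => f i x + \sum_(j <- r) f j x).
  by apply/funext => x; rewrite big_cons.
by split; [exact: integrableCD|rewrite big_cons integralCD ?ih2].
Qed.

Lemma normc_integralC f : integrableC D f ->
  normc (integralC D f) <= \int[leb]_(x in D) (`|Re (f x)| + `|Im (f x)|).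
Proof.
move=> [f1 f2]; rewrite (le_trans (ler_normcReIm _))//=.
rewrite RintegralD//; last 2 first.
- by have := integrable_norm f1; apply: eq_integrable.
- by have := integrable_norm f2; apply: eq_integrable.
by apply: lerD; exact: le_normr_Rintegral.
Qed.

Lemma decay_cvg (F : R -> R) k C : 0 < k ->
  (forall x, 0 <= x -> `|F x| <= C * expR (- k * x)) -> F x @[x --> +oo] --> (0 : R).
Proof.
move=> k0 FC.
have h : C * expR (- k * x) @[x --> +oo] --> (0 : R).
  by rewrite -[X in _ --> X](mulr0 C); apply: cvgMr; exact: expR_decay_cvg.
apply: (@squeeze_cvgr _ _ _ _ (fun x => - (C * expR (- k * x)))
  (fun x => C * expR (- k * x))) => //.
  near=> x; rewrite -ler_norml; apply: FC.
  by near: x; exact: nbhs_pinfty_ge.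
by rewrite -[X in _ --> X]oppr0; exact: cvgN.
Unshelve. all: by end_near. Qed.

Lemma integralC_FTC F f k C C' : 0 < k -> cderiv F f -> ccont f ->
  (forall x, 0 <= x -> normc (f x) <= C * expR (- k * x)) ->
  (forall x, 0 <= x -> normc (F x) <= C' * expR (- k * x)) ->
  integralC D f = - F 0.
Proof.
move=> k0 [d1 d2] [c1 c2] fC FC; apply: eq_ReIm; rewrite ?cReN ?cImN /= -sub0r.
  apply: (dominated_FTC k0 d1 c1 (C := C)).
    by move=> x x0; rewrite (le_trans (ler_Re_normc _))// fC.
  by apply: (decay_cvg k0 (C := C')) => x x0; rewrite (le_trans (ler_Re_normc _))// FC.
apply: (dominated_FTC k0 d2 c2 (C := C)).
  by move=> x x0; rewrite (le_trans (ler_Im_normc _))// fC.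
by apply: (decay_cvg k0 (C := C')) => x x0; rewrite (le_trans (ler_Im_normc _))// FC.
Qed.

Lemma cvgC_Re (u : nat -> R[i]) l : cvgC u l -> Re (u n) @[n --> \oo] --> Re l.
Proof.
move=> ul; apply/cvgrPdist_le => e e0; have /cvgrPdist_le/(_ _ e0) := ul.
apply: filterS => n; rewrite sub0r normrN ger0_norm ?normc_ge0//.
by apply: le_trans; rewrite distrC -cReN -cReD ler_Re_normc.
Qed.

Lemma cvgC_Im (u : nat -> R[i]) l : cvgC u l -> Im (u n) @[n --> \oo] --> Im l.
Proof.
move=> ul; apply/cvgrPdist_le => e e0; have /cvgrPdist_le/(_ _ e0) := ul.
apply: filterS => n; rewrite sub0r normrN ger0_norm ?normc_ge0//.
by apply: le_trans; rewrite distrC -cImN -cImD ler_Im_normc.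
Qed.

Lemma cvgC_bound (u : nat -> R[i]) l (v : nat -> R) : (forall n, normc (u n - l) <= v n) ->
  v n @[n --> \oo] --> (0 : R) -> cvgC u l.
Proof.
move=> uv v0; apply: (squeeze_cvgr _ (cvg_cst 0) v0).
by apply: nearW => n; rewrite normc_ge0 uv.
Qed.

Lemma cvgC_ReIm (u : nat -> R[i]) l : Re (u n) @[n --> \oo] --> Re l ->
  Im (u n) @[n --> \oo] --> Im l -> cvgC u l.
Proof.
move=> u1 u2; apply: (@cvgC_bound _ _ (fun n => `|Re (u n) - Re l| + `|Im (u n) - Im l|)).
  by move=> n; rewrite -cReN -cReD -cImN -cImD ler_normcReIm.
rewrite -[X in _ --> X](addr0 0); apply: cvgD.
  rewrite -[X in _ --> X](normr0 R) -(subrr (Re l)).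
  by apply: cvg_norm; apply: cvgB => //; exact: cvg_cst.
rewrite -[X in _ --> X](normr0 R) -(subrr (Im l)).
by apply: cvg_norm; apply: cvgB => //; exact: cvg_cst.
Qed.

Lemma cvgCD (u v : nat -> R[i]) l m : cvgC u l -> cvgC v m ->
  cvgC (fun n => u n + v n) (l + m).
Proof.
move=> ul vm; apply: (cvgC_bound (v := fun n => normc (u n - l) + normc (v n - m))).
  by move=> n; rewrite opprD addrACA le_normcD.
by rewrite -[X in _ --> X](addr0 0); exact: cvgD.
Qed.

Lemma cvgCZ s (u : nat -> R[i]) l : cvgC u l -> cvgC (fun n => s * u n) (s * l).
Proof.
move=> ul; apply: (cvgC_bound (v := fun n => normc s * normc (u n - l))).
  by move=> n; rewrite -mulrBr Normc.normcM.
by rewrite -[X in _ --> X](mulr0 (normc s)); apply: cvgMr.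
Qed.

Lemma integralC_cvg (u : nat -> R -> R[i]) f k C : 0 < k ->
  (forall n, ccont (u n)) ->
  (forall n x, 0 < x -> normc (u n x) <= C * expR (- k * x)) ->
  (forall x, 0 < x -> cvgC (u ^~ x) (f x)) ->
  integrableC D f /\ cvgC (fun n => integralC D (u n)) (integralC D f).
Proof.
move=> k0 cu uC uf.
have [||||i1 l1] := @dominated_Rintegral_cvg _ (fun n x => Re (u n x)) (fun x => Re (f x)) k C.
- by [].
- by move=> n; apply: measurable_funTS; apply: continuous_measurable_fun; have [] := cu n.
- by move=> n x x0; rewrite (le_trans (ler_Re_normc _))// uC.
- by move=> x x0; exact: cvgC_Re (uf x x0).
have [||||i2 l2] := @dominated_Rintegral_cvg _ (fun n x => Im (u n x)) (fun x => Im (f x)) k C.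
- by [].
- by move=> n; apply: measurable_funTS; apply: continuous_measurable_fun; have [] := cu n.
- by move=> n x x0; rewrite (le_trans (ler_Im_normc _))// uC.
- by move=> x x0; exact: cvgC_Im (uf x x0).
by split; [split|exact: cvgC_ReIm].
Qed.

End ComplexHalfLine.


(** * Laplace transforms *)

Section Laplace.
Context {R : realType}.
Implicit Types (s z w : R[i]).
Local Notation D := (`]0, +oo[%classic : set R).

(** Half of the decay rate is spent on the polynomial: two factors [e^(-k l / 4)] absorb the square
    through [1 + k l / 4 <= e^(k l / 4)]. The shift [b] will be [1 / d], because
    [l^2 (1 + 1 / (d l))^2 = (l + 1 / d)^2]. *)
Lemma sqr_decay (k b l : R) : 0 < k -> 0 <= b -> 0 <= l ->
  (l + b) ^+ 2 * expR (- k * l) <= (b + 4 / k) ^+ 2 * expR (- (k / 2) * l).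
Proof.
move=> k0 b0 l0.
have -> : expR (- k * l) = expR (- (k / 4) * l) ^+ 2 * expR (- (k / 2) * l).
  by rewrite expr2 -!expRD; congr expR; field.
rewrite mulrA -exprMn ler_wpM2r ?expR_ge0// ler_sqr ?nnegrE ?mulr_ge0 ?addr_ge0
  ?expR_ge0 ?divr_ge0 ?(ltW k0)//.
have h : 1 + k / 4 * l <= expR (k / 4 * l) by exact: expR_ge1Dx.
rewrite mulNr expRN ler_pdivrMr ?expR_gt0//.
have : (b + 4 / k) * (1 + k / 4 * l) <= (b + 4 / k) * expR (k / 4 * l).
  by rewrite ler_wpM2l// addr_ge0// divr_ge0// ltW.
apply: le_trans.
have -> : (b + 4 / k) * (1 + k / 4 * l) = l + b + (4 / k + b * (k / 4) * l).
  by field; rewrite gt_eqF.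
have k1 := ltW k0.
by rewrite lerDl; apply: addr_ge0; [exact: divr_ge0|do 2 apply: mulr_ge0 => //; exact: divr_ge0].
Qed.

Lemma lin_decay (k l : R) : 0 < k -> 0 <= l ->
  l * expR (- k * l) <= 2 / k * expR (- (k / 2) * l).
Proof.
move=> k0 l0.
have -> : expR (- k * l) = expR (- (k / 2) * l) * expR (- (k / 2) * l).
  by rewrite -!expRD; congr expR; field.
rewrite mulrA ler_wpM2r ?expR_ge0//.
have h : 1 + k / 2 * l <= expR (k / 2 * l) by exact: expR_ge1Dx.
rewrite mulNr expRN ler_pdivrMr ?expR_gt0//.
have : 2 / k * (1 + k / 2 * l) <= 2 / k * expR (k / 2 * l).
  by rewrite ler_wpM2l// divr_ge0// ltW.
apply: le_trans.
have -> : 2 / k * (1 + k / 2 * l) = l + 2 / k by field; rewrite gt_eqF.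
by rewrite lerDl divr_ge0// ltW.
Qed.

Lemma normc_expC_decay s (l : R) : normc (expC (- s * l%:C)) = expR (- Re s * l).
Proof. by rewrite normc_expC !ReImE mulr0 subr0. Qed.

Lemma laplace_cst s : 0 < Re s ->
  integrableC D (fun l => expC (- s * l%:C)) /\
  integralC D (fun l => expC (- s * l%:C)) = s^-1.
Proof.
move=> s0; have sn0 : s != 0 by apply: contraTneq s0 => ->; rewrite ltxx.
split.
  apply: (@integrableC_dom _ _ (Re s) 1 s0) => [|x _]; first exact: ccont_expC.
  by rewrite normc_expC_decay mul1r.
rewrite (@integralC_FTC _ (fun l => - s^-1 * expC (- s * l%:C)) _ (Re s) 1 (normc (- s^-1)))//.
- by rewrite mulr0 expC0 mulr1 opprK.
- apply: cderiv_eq (cderivM (cderiv_cst _) (cderiv_expC _)) _ => x.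
  by rewrite mul0r add0r mulrA mulrNN mulVf// mul1r.
- exact: ccont_expC.
- by move=> x _; rewrite normc_expC_decay mul1r.
- by move=> x _; rewrite Normc.normcM normc_expC_decay.
Qed.

Lemma laplace_id s : 0 < Re s ->
  integrableC D (fun l => l%:C * expC (- s * l%:C)) /\
  integralC D (fun l => l%:C * expC (- s * l%:C)) = s ^- 2.
Proof.
move=> s0; have sn0 : s != 0 by apply: contraTneq s0 => ->; rewrite ltxx.
have k0 : 0 < Re s / 2 by rewrite divr_gt0.
have nE x : 0 <= x -> normc (x%:C * expC (- s * x%:C)) <= 2 / Re s * expR (- (Re s / 2) * x).
  move=> x0; rewrite Normc.normcM normc_expC_decay normc_real ger0_norm//.
  exact: lin_decay.
have c : ccont (fun l : R => l%:C * expC (- s * l%:C)).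
  by apply: ccontM; [exact: ccont_id|exact: ccont_expC].
split; first by apply: (@integrableC_dom _ _ (Re s / 2) (2 / Re s) k0) => // x /ltW; exact: nE.
rewrite (@integralC_FTC _
  (fun l => - s^-1 * (l%:C * expC (- s * l%:C)) + - s ^- 2 * expC (- s * l%:C)) _
  (Re s / 2) (2 / Re s) (normc (- s^-1) * (2 / Re s) + normc (- s ^- 2)))//.
- by rewrite (_ : 0%:C = 0 :> R[i])// mul0r !mulr0 expC0 mulr1 add0r opprK.
- apply: cderiv_eq (cderivD (cderivM (cderiv_cst _) (cderivM cderiv_id (cderiv_expC _)))
    (cderivM (cderiv_cst _) (cderiv_expC _))) _ => x.
  by field.
- move=> x x0; apply: (le_trans (le_normcD _ _)); rewrite mulrDl; apply: lerD.
    by rewrite Normc.normcM -mulrA ler_wpM2l ?normc_ge0 ?nE.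
  rewrite Normc.normcM normc_expC_decay ler_wpM2l ?normc_ge0// ler_expR.
  by rewrite !mulNr lerN2 ler_wpM2r//; lra.
Qed.

End Laplace.

(** * Bounds for arithmetic-geometric sums *)

Section GeometricBounds.
Context {R : realType}.

Lemma arith_geom_sum_le (x : R) N : 0 <= x < 1 ->
  \sum_(k < N) k.+1%:R * x ^+ k.+1 <= x / (1 - x) ^+ 2.
Proof.
move=> /andP[x0 x1]; have d0 : 0 < 1 - x by rewrite subr_gt0.
rewrite ler_pdivlMr ?exprn_gt0//.
have -> : (\sum_(k < N) k.+1%:R * x ^+ k.+1) * (1 - x) ^+ 2 =
    x - x ^+ N.+1 * (N%:R * (1 - x) + 1).
  elim: N => [|N ih]; first by rewrite big_ord0 expr1; ring.
  by rewrite big_ord_recr/= mulrDl ih -natr1 !exprS; ring.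
by rewrite gerBl mulr_ge0 ?exprn_ge0// addr_ge0// mulr_ge0// ltW.
Qed.

(** These are the terms of a nonnegative series whose partial sums are bounded by
    [arith_geom_sum_le]. *)
Lemma arith_geom_cvg0 (x : R) : 0 <= x < 1 ->
  (k.+1%:R * x ^+ k.+1) @[k --> \oo] --> (0 : R).
Proof.
move=> x01; apply: cvg_series_cvg_0.
apply: nondecreasing_is_cvgn.
  apply/nondecreasing_seqP => n; rewrite /series/= big_nat_recr//= lerDl.
  by case/andP: x01 => x0 _; rewrite mulr_ge0 ?exprn_ge0.
exists (x / (1 - x) ^+ 2) => _ [n _ <-].
by rewrite /series/= big_mkord arith_geom_sum_le.
Qed.

(** From [e^(-u) <= 1 / (1 + u)] follows [1 - e^(-u) >= u / (1 + u)]. The bound displays the double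
    pole at 0 and keeps the full decay at infinity. *)
Lemma expRN_sqr_le (u : R) : 0 < u ->
  expR (- u) / (1 - expR (- u)) ^+ 2 <= expR (- u) * (1 + u^-1) ^+ 2.
Proof.
move=> u0; rewrite ler_wpM2l ?expR_ge0// -exprVn.
have d0 : 0 < 1 - expR (- u) by rewrite subr_gt0 -expR0 ltr_expR oppr_lt0.
rewrite ler_sqr ?nnegrE ?invr_ge0 ?(ltW d0) ?addr_ge0 ?invr_ge0 ?(ltW u0)//.
have -> : 1 + u^-1 = (u / (1 + u))^-1 by field; rewrite !gt_eqF// addr_gt0.
rewrite lef_pV2 ?posrE//; last by rewrite divr_gt0// addr_gt0.
have h := @expR_ge1Dx R u.
have : expR (- u) <= (1 + u)^-1 by rewrite expRN lef_pV2 ?posrE ?expR_gt0 ?addr_gt0.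
have -> : u / (1 + u) = 1 - (1 + u)^-1 by field; rewrite gt_eqF// addr_gt0.
lra.
Qed.

Lemma size_zbox N : size (zbox N) = (N.*2.+1)%N.
Proof. by elim: N => //= N ->. Qed.

(** The weights in a slice add up to [2 (2 k + 1) + 2 = 4 (k + 1)]. *)
Lemma cone_slice_le (u : int -> R) k (B : R) : (forall n, (`|n| <= k.+1)%N -> u n <= B) ->
  cone_slice u k <= 4 * (k.+1%:R * B).
Proof.
move=> uB; rewrite /cone_slice.
have hs : k.*2.+1%:R = 2 * k%:R + 1 :> R by rewrite -natr1 -mul2n natrM.
have h : \sum_(n <- zbox k) u n <= (2 * k%:R + 1) * B.
  have -> : (2 * k%:R + 1) * B = \sum_(n <- zbox k) B.
    by rewrite big_const_seq count_predT size_zbox iter_addr_0 -[RHS]mulr_natl -hs.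
  rewrite !big_seq; apply: ler_sum => n; rewrite mem_zbox => nk.
  by apply: uB; exact: leqW.
have h1 : u k.+1 <= B by apply: uB; lia.
have h2 : u (- k.+1%:Z) <= B by apply: uB; lia.
rewrite -(natr1 k) mulr2n.
have -> : 4 * ((k%:R + 1) * B) = (2 * k%:R + 1) * B + (2 * k%:R + 1) * B + (B + B) by ring.
by do 2 apply: lerD => //; apply: lerD.
Qed.

End GeometricBounds.


(** * The sum over one cone *)

Section Cone.
Context {R : realType}.
Local Notation leb := (@lebesgue_measure R).
Local Notation D := (`]0, +oo[%classic : set R).
Variables (mu nu : R[i]) (r C : R) (phi : R -> R[i]) (g : R[i] -> R[i]).
Hypothesis phi_cont : ccont phi.
Hypothesis phi_le : forall l, 0 < l -> normc (phi l) <= C * l ^+ 2 * expR (r * l).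
Hypothesis r_lt : r + `|Re nu| < Re mu.
Hypothesis r_ge0 : 0 <= r.
Hypothesis C_ge0 : 0 <= C.
Hypothesis g_laplace : forall w, r < Re w ->
  integralC D (fun l => phi l * expC (- w * l%:C)) = g w.

(* Closed form of the sum over [m, n] of [e^(-(m mu + n nu) l) *+ cone_weight m n]. *)
Definition cone_kernel (l : R) : R[i] :=
  let q := expC (- mu * l%:C) in let a := expC (nu * l%:C) in
  q * (a + 2 + a^-1) / (1 - q * (a + a^-1) + q ^+ 2).

Definition box N : seq (int * int) := [seq (m, n) | m <- zbox N, n <- zbox N].

Let pt (p : int * int) : R[i] := p.1%:~R * mu + p.2%:~R * nu.
Let wt (p : int * int) : nat := cone_weight p.1 p.2.
Let term (p : int * int) (l : R) : R[i] := (phi l * expC (- pt p * l%:C)) *+ wt p.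
(** The rate of growth of [Re (pt p)] per unit of [m], valid on the whole cone. *)
Let d := Re mu - `|Re nu|.

Let d_gt0 : 0 < d. Proof. by rewrite /d; move: r_lt r_ge0; lra. Qed.

Let pt_ge p : (0 < wt p)%N -> p.1%:~R * d <= Re (pt p).
Proof.
move=> /cone_weight_gt0[np m0]; rewrite /pt !ReImE !mul0r !subr0 /d mulrBr lerD2l.
rewrite lerNl; apply: (le_trans (ler_norm _)); rewrite normrN normrM.
by rewrite ler_wpM2r// -intr_norm ler_int.
Qed.

Let r_lt_pt p : (0 < wt p)%N -> r < Re (pt p).
Proof.
move=> wp; apply: lt_le_trans (pt_ge wp); apply: (@lt_le_trans _ _ d).
  by rewrite /d ltrBrDr.
have [_ m0] := cone_weight_gt0 wp; rewrite ler_peMl ?(ltW d_gt0)//.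
by rewrite -[1]/(1%:~R) ler_int.
Qed.

Let normc_laplace w l : 0 < l ->
  normc (phi l * expC (- w * l%:C)) <= C * (l ^+ 2 * expR (- (Re w - r) * l)).
Proof.
move=> l0; rewrite Normc.normcM normc_expC_decay.
apply: (le_trans (ler_wpM2r (expR_ge0 _) (phi_le l0))).
rewrite -!mulrA -expRD !ler_wpM2l ?(ltW l0)// ler_expR.
by rewrite le_eqVlt; apply/orP; left; apply/eqP; ring.
Qed.

Let integrable_laplace w : r < Re w -> integrableC D (fun l => phi l * expC (- w * l%:C)).
Proof.
move=> rw; have k0 : 0 < Re w - r by rewrite subr_gt0.
apply: (@integrableC_dom _ _ ((Re w - r) / 2) (C * (4 / (Re w - r)) ^+ 2)).
- by rewrite divr_gt0.
- by apply: ccontM => //; exact: ccont_expC.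
- move=> l l0; apply: (le_trans (normc_laplace w l0)); rewrite -mulrA ler_wpM2l//.
  have := @sqr_decay R _ 0 l k0 (lexx 0) (ltW l0).
  by rewrite addr0 add0r.
Qed.

Let term_integrable p : integrableC D (term p) /\ integralC D (term p) = g (pt p) *+ wt p.
Proof.
(* Outside the cone [Re (pt p)] may be at most [r] and the Laplace integral may diverge; there the
   weight 0 settles both claims. *)
rewrite /term; have [w0|w0] := posnP (wt p).
  rewrite w0 mulr0n.
  have -> : (fun l => (phi l * expC (- pt p * l%:C)) *+ 0) = (fun=> 0) by apply/funext.
  by split; [exact: integrableC0|exact: integralC0].
have -> : (fun l => (phi l * expC (- pt p * l%:C)) *+ wt p) =
   (fun l => (wt p)%:R * (phi l * expC (- pt p * l%:C))).
  by apply/funext => l; rewrite mulr_natl.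
have iw := integrable_laplace (r_lt_pt w0).
split; first exact: integrableCZ.
by rewrite integralCZ// g_laplace ?r_lt_pt// mulr_natl.
Qed.

(** The 4 is that of [cone_slice_le]; the square comes from [sqr_decay] with rate [d - r] and shift
    [d^-1]. *)
Let K := 4 * C * (d^-1 + 4 / (d - r)) ^+ 2.

Let expC_pt m n l : expC (- pt (m, n) * l%:C) =
  expC (- mu * l%:C) ^ m * expC (- nu * l%:C) ^ n.
Proof. by rewrite -!expC_int -expCD /pt /=; congr expC; ring. Qed.

Let x_bnd l : 0 < l -> 0 <= expR (- d * l) < 1.
Proof.
by move=> l0; rewrite expR_ge0 -expR0 ltr_expR mulNr oppr_lt0 mulr_gt0.
Qed.

Let normc_expC_pt k n l : 0 < l -> (`|n| <= k.+1)%N ->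
  normc (expC (- pt (k.+1%:Z, n) * l%:C)) <= expR (- d * l) ^+ k.+1.
Proof.
move=> l0 nk; rewrite normc_expC_decay -expRM_natl ler_expR !mulNr mulrN lerN2.
rewrite mulrA ler_wpM2r ?(ltW l0)//.
rewrite /pt !ReImE !mul0r !subr0 /= /d mulrBr lerD2l lerNl.
apply: (le_trans (ler_norm _)); rewrite normrN normrM ler_wpM2r//.
by rewrite -intr_norm -[k.+1%:R]/(k.+1%:Z%:~R) ler_int; lia.
Qed.

(** On the slice [m = k + 1] every exponential is at most [x^(k+1)] with [x = e^(-d l)], so the
    slices are bounded by an arithmetic-geometric series. Its double pole cancels against the [l^2]
    of [phi_le], which leaves a pure exponential independent of [N]. *)
Let sum_normc_le N l : 0 < l ->
  \sum_(p <- box N) normc (term p l) <= K * expR (- ((d - r) / 2) * l).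
Proof.
move=> l0; rewrite /box big_allpairs/=.
pose u m n := normc (phi l * expC (- pt (m, n) * l%:C)).
have -> : \sum_(m <- zbox N) \sum_(n <- zbox N) normc (term (m, n) l) =
    \sum_(m <- zbox N) \sum_(n <- zbox N) u m n *+ cone_weight m n.
  by apply: eq_bigr => m _; apply: eq_bigr => n _; rewrite /term normcMn.
rewrite big_cone.
have P0 : 0 <= C * l ^+ 2 * expR (r * l).
  by rewrite !mulr_ge0 ?expR_ge0 ?exprn_ge0 ?(ltW l0).
have slice k : cone_slice (u k.+1) k <=
    4 * (C * l ^+ 2 * expR (r * l)) * (k.+1%:R * expR (- d * l) ^+ k.+1).
  have := @cone_slice_le R (u k.+1) k
    (C * l ^+ 2 * expR (r * l) * expR (- d * l) ^+ k.+1).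
  move=> /(_ _)/le_trans; apply => [n nk|]; last first.
    by rewrite le_eqVlt; apply/orP; left; apply/eqP; ring.
  rewrite /u Normc.normcM; apply: ler_pM; rewrite ?normc_ge0 ?phi_le//.
  exact: normc_expC_pt.
apply: (@le_trans _ _ (\sum_(k < N) 4 * (C * l ^+ 2 * expR (r * l)) *
    (k.+1%:R * expR (- d * l) ^+ k.+1))).
  by apply: ler_sum => k _; exact: slice.
rewrite -mulr_sumr.
have dl0 : 0 < d * l by rewrite mulr_gt0.
have h := arith_geom_sum_le N (x_bnd l0).
have h' := expRN_sqr_le dl0; rewrite -mulNr in h'.
apply: (le_trans (ler_wpM2l _ (le_trans h h'))); first by rewrite mulr_ge0.
have dr0 : 0 < d - r by rewrite /d subr_gt0 ltrBrDr.
have hs := @sqr_decay R (d - r) d^-1 l dr0.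
rewrite /K -[leRHS]mulrA.
apply: le_trans (ler_wpM2l _ (hs _ _)); last 3 first.
- by rewrite mulr_ge0.
- by rewrite invr_ge0 ltW.
- exact: ltW.
rewrite -[leLHS]/(4 * (C * l ^+ 2 * expR (r * l)) * (expR (- d * l) * (1 + (d * l)^-1) ^+ 2)).
have -> : expR (- (d - r) * l) = expR (r * l) * expR (- d * l).
  by rewrite -expRD; congr expR; ring.
rewrite le_eqVlt; apply/orP; left; apply/eqP.
by field; rewrite !gt_eqF.
Qed.

(** Supplies the absolute bound that [sum_exhaustion] asks for. The factor 2 below comes from
    bounding [|Re| + |Im|] by twice the norm. *)
Lemma cone_sum_normc_le : exists K' : R, forall N,
  \sum_(p <- box N) normc (g (pt p)) *+ wt p <= K'.
Proof.
(* A real function viewed as complex, so that [integrableC_sum] exchanges the finite sum and the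
   integral. *)
pose H p l : R[i] := (`|Re (term p l)| + `|Im (term p l)|)%:C.
have iH p : integrableC D (H p).
  have [[i1 i2] _] := term_integrable p.
  split; last exact: integrable0.
  by apply: eq_integrable (integrableD _ (integrable_norm i1) (integrable_norm i2)).
exists (\int[leb]_(l in D) (2 * K * expR (- ((d - r) / 2) * l))) => N.
apply: (@le_trans _ _ (\sum_(p <- box N) Re (integralC D (H p)))).
  apply: ler_sum => p _; have [ip E] := term_integrable p.
  by rewrite -normcMn -E /=; exact: normc_integralC.
have [[i1 _] E] := integrableC_sum (box N) iH.
have -> : \sum_(p <- box N) Re (integralC D (H p)) = Re (\sum_(p <- box N) integralC D (H p)).
  by elim/big_ind2: _ => // a b x y -> ->; rewrite cReD.
rewrite -E /=; apply: le_Rintegral => //.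
  by apply: expR_decay_integrable; rewrite divr_gt0// /d subr_gt0 ltrBrDr.
move=> l; rewrite /= in_itv/= andbT => l0.
have -> : Re (\sum_(p <- box N) H p l) = \sum_(p <- box N) (`|Re (term p l)| + `|Im (term p l)|).
  by elim/big_ind2: _ => // a b x y <- <-; rewrite cReD.
apply: (@le_trans _ _ (\sum_(p <- box N) 2 * normc (term p l))).
  by apply: ler_sum => p _; rewrite mulrDl mul1r lerD ?ler_Re_normc ?ler_Im_normc.
by rewrite -mulr_sumr -mulrA ler_wpM2l// sum_normc_le.
Qed.

Let kernel_cvg l : 0 < l ->
  cvgC (fun N => \sum_(p <- box N) term p l) (phi l * cone_kernel l).
Proof.
(* This [a] is the inverse of the one in [cone_kernel], whose formula is symmetric in [a] and
   [a^-1]. *)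
move=> l0; pose q := expC (- mu * l%:C); pose a := expC (- nu * l%:C).
have a0 : a != 0 by exact: expC_neq0.
have E N : \sum_(p <- box N) term p l =
    phi l * \sum_(k < N) q ^+ k.+1 * cone_slice (fun n => a ^ n) k.
  rewrite /box big_allpairs/= mulr_sumr.
  have -> : \sum_(m <- zbox N) \sum_(n <- zbox N) term (m, n) l =
    \sum_(m <- zbox N) \sum_(n <- zbox N) (phi l * (q ^ m * a ^ n)) *+ cone_weight m n.
    by apply: eq_bigr => m _; apply: eq_bigr => n _; rewrite /term expC_pt.
  rewrite big_cone; apply: eq_bigr => k _; rewrite /cone_slice.
  by rewrite !(mulrDr, mulrnAr, mulr_sumr).
under [X in cvgC X]eq_fun do rewrite E.
apply: cvgCZ.
have aE : expC (nu * l%:C) = a^-1 by rewrite /a mulNr expCN invrK.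
rewrite /cone_kernel -/q aE invrK.
pose den := 1 - q * (a^-1 + a) + q ^+ 2.
pose x := expR (- d * l).
have qt k : normc (q ^+ k.+1 * cone_slice (fun n => a ^ n) k) <= 4 * (k.+1%:R * x ^+ k.+1).
  have := @cone_slice_le R (fun n => normc (q ^+ k.+1 * a ^ n)) k (x ^+ k.+1).
  move=> /(_ _)/(le_trans _); apply.
    rewrite /cone_slice mulrDr mulrnAr mulr_sumr mulrDr.
    apply: (le_trans (le_normcD _ _)); rewrite normcMn; apply: lerD; last exact: le_normcD.
    by rewrite lerMn2r/= ler_normc_sum.
  by move=> n nk; have := @normc_expC_pt k n l l0 nk; rewrite expC_pt.
(* The denominator factors as [(1 - q a) (1 - q a^-1)]. The products [q a] and [q a^-1] are the
   exponentials at the lattice points [(1, 1)] and [(1, -1)], of modulus at most [e^(-d l) < 1]. *)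
have qa b : b = a \/ b = a^-1 -> 1 - q * b != 0.
  move=> hb; rewrite subr_eq0; apply/eqP => h1.
  suff : normc (q * b) < 1 by rewrite -h1 Normc.normc1 ltxx.
  have /andP[_ x1] := x_bnd l0; apply: le_lt_trans x1; rewrite -[leRHS]expr1.
  case: hb => ->.
    have := @normc_expC_pt 0 1 l l0 isT.
    by rewrite expC_pt.
  have := @normc_expC_pt 0 (-1) l l0 isT.
  by rewrite expC_pt.
have den0 : den != 0.
  have -> : den = (1 - q * a) * (1 - q * a^-1) by rewrite /den; field.
  by rewrite mulf_neq0 ?qa//; [left|right].
have q1 : normc q <= 1.
  rewrite /q normc_expC_decay -expR0 ler_expR mulNr oppr_le0 mulr_ge0 ?(ltW l0)//.
  by apply: ltW; move: r_lt r_ge0 (normr_ge0 (Re nu)); lra.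
(* [cone_series] concerns sums of [N + 1] terms, hence the shift of index. *)
rewrite /cvgC -cvg_shiftS/=.
pose v k := k.+1%:R * x ^+ k.+1.
apply: (@cvgC_bound _ _ _ (fun N => (4 * v N.+1 + 4 * v N) * (normc den)^-1)).
  move=> N; rewrite ler_pdivlMr; last first.
    by rewrite lt_neqAle normc_ge0 eq_sym andbT; apply: contra den0 => /eqP/Normc.eq0_normc ->.
  rewrite -Normc.normcM mulrBl divfK// mulrC /den (addrC a^-1).
  rewrite (cone_series q a0 N) (addrAC a) .
  have -> : q * (a + a^-1 + 2) - q ^+ N.+2 * cone_slice (fun n => a ^ n) N.+1 +
      q ^+ N.+3 * cone_slice (fun n => a ^ n) N - q * (a^-1 + 2 + a) =
    - (q ^+ N.+2 * cone_slice (fun n => a ^ n) N.+1) +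
      q ^+ 2 * (q ^+ N.+1 * cone_slice (fun n => a ^ n) N).
    by rewrite !exprS; ring.
  apply: (le_trans (le_normcD _ _)); rewrite normcN; apply: lerD; first exact: qt.
  rewrite Normc.normcM -[leRHS]mul1r; apply: ler_pM; rewrite ?normc_ge0 ?qt//.
  by rewrite expr2 Normc.normcM mulr_ile1 ?normc_ge0.
have v0 : v N @[N --> \oo] --> (0 : R) by apply: arith_geom_cvg0; exact: x_bnd.
have v1 : v N.+1 @[N --> \oo] --> (0 : R) by rewrite (cvg_shiftS v).
rewrite -[X in _ --> X](mul0r (normc den)^-1); apply: cvgMl.
rewrite -[X in _ --> X](addr0 0) -[X in _ --> X + _](mulr0 4) -[X in _ --> _ + X](mulr0 4).
by apply: cvgD; apply: cvgMr.
Qed.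

Lemma cone_integral :
  integrableC D (fun l => phi l * cone_kernel l) /\
  cvgC (fun N => \sum_(p <- box N) g (pt p) *+ wt p)
       (integralC D (fun l => phi l * cone_kernel l)).
Proof.
have dr0 : 0 < (d - r) / 2 by rewrite divr_gt0// /d subr_gt0 ltrBrDr.
have [|||i1 l1] := @integralC_cvg R (fun N l => \sum_(p <- box N) term p l)
  (fun l => phi l * cone_kernel l) _ K dr0.
- move=> N; apply: ccont_sum => p; rewrite /term.
  have -> : (fun l => (phi l * expC (- pt p * l%:C)) *+ wt p) =
     (fun l => (wt p)%:R * (phi l * expC (- pt p * l%:C))).
    by apply/funext => l; rewrite mulr_natl.
  by apply: ccontM; [exact: ccont_cst|apply: ccontM => //; exact: ccont_expC].
- by move=> N l l0; apply: (le_trans (ler_normc_sum _ _)); exact: sum_normc_le.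
- by move=> l l0; exact: kernel_cvg.
split=> //.
have -> : (fun N => \sum_(p <- box N) g (pt p) *+ wt p) =
    (fun N => integralC D (fun l => \sum_(p <- box N) term p l)).
  apply/funext => N.
  rewrite (integrableC_sum (box N) (fun p => (term_integrable p).1)).2.
  by apply: eq_bigr => p _; rewrite (term_integrable p).2.
exact: l1.
Qed.

End Cone.


(** * The sum over the lattice *)

Section BoxSymmetry.
Context {V : nmodType}.
Implicit Types u : int * int -> V.

Lemma big_box_opp N u : \sum_(p <- box N) u (- p.1, - p.2) = \sum_(p <- box N) u p.
Proof.
rewrite /box !big_allpairs /= (big_zbox_opp N (fun m => \sum_(n <- zbox N) u (m, - n))).
by apply: eq_bigr => m _; rewrite (big_zbox_opp N (fun n => u (m, n))).
Qed.

Lemma big_box_swap N u : \sum_(p <- box N) u (p.2, p.1) = \sum_(p <- box N) u p.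
Proof. by rewrite /box !big_allpairs /= exchange_big. Qed.

Lemma big_box_weights N u :
  \sum_(p <- box N) u p *+ (cone_weight p.1 p.2 + cone_weight (- p.1) (- p.2) +
     (cone_weight p.2 p.1 + cone_weight (- p.2) (- p.1))) =
  \sum_(p <- box N) u p *+ cone_weight p.1 p.2 +
  \sum_(p <- box N) u (- p.1, - p.2) *+ cone_weight p.1 p.2 +
  (\sum_(p <- box N) u (p.2, p.1) *+ cone_weight p.1 p.2 +
   \sum_(p <- box N) u (- p.2, - p.1) *+ cone_weight p.1 p.2).
Proof.
have split4 (f1 f2 f3 f4 : int * int -> nat) :
    \sum_(p <- box N) u p *+ (f1 p + f2 p + (f3 p + f4 p)) =
    \sum_(p <- box N) u p *+ f1 p + \sum_(p <- box N) u p *+ f2 p +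
    (\sum_(p <- box N) u p *+ f3 p + \sum_(p <- box N) u p *+ f4 p).
  by under eq_bigr do rewrite !mulrnDr; rewrite !big_split.
rewrite (split4 (fun p => cone_weight p.1 p.2) (fun p => cone_weight (- p.1) (- p.2))
  (fun p => cone_weight p.2 p.1) (fun p => cone_weight (- p.2) (- p.1))).
have <- := big_box_opp N (fun p => u p *+ cone_weight (- p.1) (- p.2)).
have <- := big_box_swap N (fun p => u p *+ cone_weight p.2 p.1).
have <- := big_box_swap N (fun p => u p *+ cone_weight (- p.2) (- p.1)).
have <- := big_box_opp N (fun p => u (p.2, p.1) *+ cone_weight (- p.1) (- p.2)).
by congr (_ + _ + (_ + _)); apply: eq_bigr => -[m n] _ /=; rewrite ?opprK.
Qed.

End BoxSymmetry.

(** * From the four cones to the whole lattice *)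

Section Assembly.
Context {R : realType}.
Local Notation D := (`]0, +oo[%classic : set R).
Variables (g : R[i] -> R[i] -> R[i]) (phi : R[i] -> R -> R[i]) (C : R[i] -> R) (k : nat).
Hypothesis g_hom : forall c z w, c != 0 -> g z w = c ^+ k * g (c * z) (c * w).
Hypothesis phi_cont : forall z, ccont (phi z).
Hypothesis C_ge0 : forall z, 0 <= C z.
Hypothesis phi_le : forall z l, 0 < l ->
  normc (phi z l) <= C z * l ^+ 2 * expR (`|Re z| * l).
Hypothesis g_laplace : forall z w, `|Re z| < Re w ->
  integralC D (fun l => phi z l * expC (- w * l%:C)) = g z w.

Variables (tau z : R[i]).
Hypothesis z_re : `|Re z| + `|Re tau| < 1.
Hypothesis z_im : `|Im z| < Im tau.

Let pt (p : int * int) : R[i] := p.1%:~R * 1 + p.2%:~R * tau.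
Let wt (p : int * int) : nat := cone_weight p.1 p.2.
Let i : R[i] := 'i%C.

(* Since cone weights are doubled, this integrates to twice the lattice sum. *)
Definition lattice_kernel (l : R) : R[i] :=
  (phi z l * cone_kernel 1 tau l +
   (-1) ^+ k * (phi (-1 * z) l * cone_kernel 1 tau l)) +
  ((- i) ^+ k * (phi (- i * z) l * cone_kernel (- i * tau) (- i) l) +
   i ^+ k * (phi (i * z) l * cone_kernel (- i * tau) (- i) l)).

Let tau_im : 0 < Im tau. Proof. exact: le_lt_trans (normr_ge0 _) z_im. Qed.

Let pt_inj : injective pt.
Proof.
move=> [m n] [m' n']; rewrite /pt /= => h.
have /eqP := congr1 (fun s : R[i] => Im s) h.
rewrite !ReImE !mulr0 !mul0r !addr0 !add0r /=.
rewrite -subr_eq0 -mulrBl mulf_eq0 (gt_eqF tau_im) orbF subr_eq0 eqr_int => /eqP nn.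
move: h; rewrite nn => /addIr; rewrite !mulr1 => /(congr1 (fun s : R[i] => Re s)).
by rewrite !Re_int => /eqP; rewrite eqr_int => /eqP ->.
Qed.

Let pt00 : pt (0, 0) = 0. Proof. by rewrite /pt /= !mul0r addr0. Qed.

Let i_neq0 : i != 0.
Proof. by apply/eqP => /(congr1 (fun s : R[i] => Im s)) /= /eqP; rewrite oner_eq0. Qed.

(** [sigma] relabels the lattice so that multiplication by [c] carries the chosen cone to [|n| <= m]
    for the generators [mu], [nu]. Opposite cones then share these generators, hence the kernel, and
    differ only in the sign of [c]. *)
Let cone mu nu s c : c != 0 -> `|Re (c * z)| + `|Re nu| < Re mu -> c ^+ k = s ->
  forall (sigma : int * int -> R[i]),
  (forall p, c * sigma p = p.1%:~R * mu + p.2%:~R * nu) ->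
  [/\ integrableC D (fun l => s * (phi (c * z) l * cone_kernel mu nu l)),
      cvgC (fun N => \sum_(p <- box N) g z (sigma p) *+ wt p)
        (integralC D (fun l => s * (phi (c * z) l * cone_kernel mu nu l)))
    & exists K : R, forall N, \sum_(p <- box N) normc (g z (sigma p)) *+ wt p <= K].
Proof.
move=> c0 cz <- sigma cE.
have E p : g z (sigma p) = c ^+ k * g (c * z) (p.1%:~R * mu + p.2%:~R * nu).
  by rewrite (g_hom _ _ c0) cE.
have [i1 l1] := cone_integral (phi_cont _) (@phi_le (c * z)) cz (normr_ge0 _)
  (C_ge0 _) (@g_laplace (c * z)).
have [K b1] := cone_sum_normc_le (phi_cont _) (@phi_le (c * z)) cz (normr_ge0 _)
  (C_ge0 _) (@g_laplace (c * z)).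
split; first exact: integrableCZ.
  rewrite integralCZ//; have := cvgCZ (c ^+ k) l1; congr cvgC.
  apply/funext => N; rewrite mulr_sumr; apply: eq_bigr => p _.
  by rewrite E mulrnAr.
exists (normc (c ^+ k) * K) => N; apply: le_trans (ler_wpM2l (normc_ge0 _) (b1 N)).
rewrite le_eqVlt; apply/orP; left; apply/eqP; rewrite mulr_sumr.
by apply: eq_bigr => p _; rewrite E Normc.normcM mulrnAr.
Qed.

Lemma lattice_sum :
  integrableC D lattice_kernel /\
  sumC (lattice 1 tau `\ 0) (g z) = 2^-1 * integralC D lattice_kernel.
Proof.
have cE : `|Re (1 * z)| + `|Re tau| < Re 1 by rewrite mul1r.
have cW : `|Re (-1 * z)| + `|Re tau| < Re 1 by rewrite mulN1r cReN normrN.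
have reNi s : Re (- i * s) = Im s.
  have [Ri Ii] : Re i = 0 /\ Im i = 1 by [].
  by rewrite cReM cReN cImN Ri Ii; ring.
have Re_Ni : Re (- i) = 0 by rewrite cReN -[Re i]/(0 : R) oppr0.
have cN : `|Re (- i * z)| + `|Re (- i)| < Re (- i * tau).
  by rewrite (reNi z) (reNi tau) Re_Ni normr0 addr0.
have cS : `|Re (i * z)| + `|Re (- i)| < Re (- i * tau).
  have -> : Re (i * z) = - Re (- i * z) by rewrite mulNr cReN opprK.
  by rewrite normrN (reNi z) (reNi tau) Re_Ni normr0 addr0.
(* The suffixes E, W, N, S stand for the cones around [1], [-1], [tau] and [- tau]. *)
have [||iE lE [KE bE]] := cone (s := 1) (oner_neq0 _) cE _ (sigma := pt) _.
- by rewrite expr1n.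
- by move=> p; rewrite mul1r.
have [||iW lW [KW bW]] := cone (s := (-1) ^+ k) _ cW erefl
    (sigma := fun p => pt (- p.1, - p.2)) _.
- by rewrite oppr_eq0 oner_neq0.
- by move=> p; rewrite /pt /= !mulrNz; ring.
have ii : i * i = -1 by have := sqr_i R; rewrite expr2.
have [||iN lN [KN bN]] := cone (s := (- i) ^+ k) _ cN erefl
    (sigma := fun p => pt (p.2, p.1)) _.
- by rewrite oppr_eq0.
- by move=> p; rewrite /pt /=; ring.
have [|iS lS [KS bS]] := cone (s := i ^+ k) i_neq0 cS erefl
    (sigma := fun p => pt (- p.2, - p.1)) _.
- by move=> p; rewrite /pt /= !mulrNz; ring.
have iEW := integrableCD iE iW; have iNS := integrableCD iN iS.
have kE l : lattice_kernel l =
   (1 * (phi (1 * z) l * cone_kernel 1 tau l) +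
   (-1) ^+ k * (phi (-1 * z) l * cone_kernel 1 tau l)) +
  ((- i) ^+ k * (phi (- i * z) l * cone_kernel (- i * tau) (- i) l) +
   i ^+ k * (phi (i * z) l * cone_kernel (- i * tau) (- i) l)).
  by rewrite !mul1r.
have iL : integrableC D lattice_kernel.
  by apply: eq_integrableC (integrableCD iEW iNS) => l _; rewrite kE.
split => //.
pose G w : R[i] := if w \in lattice 1 tau `\ 0 then g z w else 0.
(* At the origin all four weights vanish and so does [G]; this is where [F 0 = 0] enters. The
   identity serves for the values ([F] the identity) and for the norms ([F] the modulus). *)
have GE (V : nmodType) (F : R[i] -> V) p : F 0 = 0 -> F (G (pt p)) *+ 2 =
    F (g z (pt p)) *+ (cone_weight p.1 p.2 + cone_weight (- p.1) (- p.2) +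
     (cone_weight p.2 p.1 + cone_weight (- p.2) (- p.1))).
  case: p => m n F0; have [/eqP|h] := boolP ((m, n) == (0, 0)).
    move=> [-> ->]; rewrite /cone_weight pt00 /G memNset ?F0 ?mul0rn ?mulr0n//=.
    by move=> [_]; apply.
  rewrite cone_weight_partition; last by move: h; rewrite xpair_eqE negb_and.
  rewrite /G mem_set//; split; first by exists m, n.
  by move=> /= /eqP; rewrite -pt00 (inj_eq pt_inj); apply/negP.
pose B N : {fset R[i]} := [fset w in map pt (box N)]%fset.
have uniq_box N : uniq (map pt (box N)).
  rewrite map_inj_uniq//; apply: allpairs_uniq; rewrite ?uniq_zbox//.
  by move=> [m n] [m' n'] _ _ [-> ->].
have BE (V : nmodType) (F : R[i] -> V) N : \sum_(w <- B N) F w = \sum_(p <- box N) F (pt p).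
  rewrite -(big_map pt xpredT F); apply: perm_big; apply: uniq_perm => //.
  by move=> w; rewrite inE.
have halfV : forall a b : R[i], a *+ 2 = b -> a = 2^-1 * b.
  by move=> a b <-; rewrite -[a *+ 2]mulr_natl mulKf ?pnatr_eq0.
rewrite /sumC; apply: (@sum_exhaustion _ _ G B _ ((KE + KW + (KN + KS)))).
- move=> w; rewrite /G; case: ifPn => [|_]; last by rewrite eqxx.
  rewrite inE => -[[m [n ->]] _] _; exists (maxn `|m| `|n|) => N.
  rewrite geq_max => /andP[mN nN]; rewrite inE; apply/mapP; exists (m, n) => //.
  by apply/allpairsP; exists (m, n); rewrite !mem_zbox.
(* Doubling the norms only weakens the bound and matches the doubled weights, so the four cone
   constants are simply added. *)
- move=> N; rewrite BE; apply: (@le_trans _ _ (\sum_(p <- box N) normc (G (pt p)) *+ 2)).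
    by apply: ler_sum => p _; rewrite mulr2n lerDl normc_ge0.
  rewrite (eq_bigr _ (fun p _ => GE _ _ p (Normc.normc0 R))).
  rewrite (big_box_weights N (fun p => normc (g z (pt p)))).
  by apply: lerD; apply: lerD.
- have -> : (fun N => \sum_(w <- B N) G w) = (fun N => 2^-1 *
      (\sum_(p <- box N) g z (pt p) *+ wt p +
       \sum_(p <- box N) g z (pt (- p.1, - p.2)) *+ wt p +
       (\sum_(p <- box N) g z (pt (p.2, p.1)) *+ wt p +
        \sum_(p <- box N) g z (pt (- p.2, - p.1)) *+ wt p))).
    apply/funext => N; rewrite BE; apply: halfV.
    rewrite -(big_box_weights N (fun p => g z (pt p))) -sumrMnl.
    by apply: eq_bigr => p _; rewrite (GE _ id).
  apply: cvgCZ.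
  rewrite (eq_integralC (fun l _ => kE l)) integralCD// !integralCD//.
  exact: cvgCD (cvgCD lE lW) (cvgCD lN lS).
Qed.

End Assembly.


(** * The summands and the integrands *)

Section Transforms.
Context {R : realType}.
Local Notation D := (`]0, +oo[%classic : set R).
Implicit Types (z w c : R[i]) (l : R).

Definition wp_term z w : R[i] := 1 / (z - w) ^+ 2 - 1 / w ^+ 2.
Definition wzeta_term z w : R[i] := 1 / (z - w) + 1 / w + z / w ^+ 2.

(** Holds at the poles too, since inversion is multiplicative even at 0 with [0^-1 = 0]. For this
    reason the inverses are split by [invfM], without side conditions on [w] or [z - w]. *)
Lemma wp_term_hom c z w : c != 0 -> wp_term z w = c ^+ 2 * wp_term (c * z) (c * w).
Proof.
move=> c0; rewrite /wp_term -(mulrBr c z w) !exprMn !mul1r.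
have invM (x y : R[i]) : (x * y)^-1 = x^-1 * y^-1 := invfM x y.
rewrite (invM (c ^+ 2) ((z - w) ^+ 2)) (invM (c ^+ 2) (w ^+ 2)).
by rewrite mulrBr !mulVKf ?expf_neq0.
Qed.

Lemma wzeta_term_hom c z w : c != 0 ->
  wzeta_term z w = c ^+ 1 * wzeta_term (c * z) (c * w).
Proof.
move=> c0; rewrite /wzeta_term -(mulrBr c z w) exprMn !mul1r expr1.
have invM (x y : R[i]) : (x * y)^-1 = x^-1 * y^-1 := invfM x y.
rewrite (invM c (z - w)) (invM c w) (invM (c ^+ 2) (w ^+ 2)).
rewrite !mulrDr !mulVKf//; congr (_ + _).
rewrite -[w ^- 2 in LHS](mulVKf (expf_neq0 2 c0)); ring.
Qed.

Definition wp_phi z l : R[i] := l%:C * (expC (z * l%:C) - 1).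
Definition wzeta_phi z l : R[i] := 1 + z * l%:C - expC (z * l%:C).

Lemma ccont_wp_phi z : ccont (wp_phi z).
Proof.
apply: ccontM; first exact: ccont_id.
by apply: ccontD; [exact: ccont_expC|exact: ccont_cst].
Qed.

Lemma wzeta_phiE z : wzeta_phi z = (fun l => (1 + z * l%:C) + -1 * expC (z * l%:C)).
Proof. by apply/funext => l; rewrite mulN1r. Qed.

Lemma ccont_wzeta_phi z : ccont (wzeta_phi z).
Proof.
rewrite wzeta_phiE; apply: ccontD; last exact: ccontM (ccont_cst _) (ccont_expC _).
by apply: ccontD; [exact: ccont_cst|exact: ccontM (ccont_cst _) ccont_id].
Qed.

(** The mean value theorem is applied to the two coordinates, generally with different intermediate
    points; this costs the factor 2. *)
Lemma normc_mvt (F f : R -> R[i]) (l M : R) : 0 < l -> cderiv F f -> F 0 = 0 ->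
  (forall t, 0 < t < l -> normc (f t) <= M) -> normc (F l) <= 2 * M * l.
Proof.
move=> l0 Ff F0 fM; have [c1 c2] := cderiv_ccont Ff; have [d1 d2] := Ff.
apply: (le_trans (ler_normcReIm _)).
have h (G G' : R -> R) : (forall x, is_derive x (1 : R) G (G' x)) -> continuous G ->
    G 0 = 0 -> (forall t, 0 < t < l -> `|G' t| <= M) -> `|G l| <= M * l.
  move=> dG cG G0 GM.
  have [t tl] := @MVT R G G' 0 l l0 (fun x _ => dG x) (continuous_subspaceT cG).
  rewrite G0 !subr0 => ->; rewrite normrM (gtr0_norm l0) ler_wpM2r ?(ltW l0)//.
  by apply: GM; move: tl; rewrite in_itv.
have -> : 2 * M * l = M * l + M * l by ring.
apply: lerD.
  apply: (h _ _ d1 c1); first by rewrite F0.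
  by move=> t /fM; apply: le_trans; exact: ler_Re_normc.
apply: (h _ _ d2 c2); first by rewrite F0.
by move=> t /fM; apply: le_trans; exact: ler_Im_normc.
Qed.

Lemma expR_Re_le z t l : 0 <= t <= l -> expR (Re z * t) <= expR (`|Re z| * l).
Proof.
move=> /andP[t0 tl]; rewrite ler_expR.
by apply: (le_trans (ler_wpM2r t0 (ler_norm _))); exact: ler_wpM2l.
Qed.

Lemma normc_expC_sub1 z l : 0 < l ->
  normc (expC (z * l%:C) - 1) <= 2 * normc z * l * expR (`|Re z| * l).
Proof.
move=> l0; rewrite mulrAC.
have := @normc_mvt (fun t => expC (z * t%:C) + -1) (fun t => z * expC (z * t%:C) + 0)
  l (normc z * expR (`|Re z| * l)) l0 (cderivD (cderiv_expC z) (cderiv_cst _)).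
rewrite -[2 * normc z * _]mulrA; apply.
  by rewrite (_ : 0%:C = 0 :> R[i])// mulr0 expC0 subrr.
move=> t /andP[t0 tl]; rewrite addr0 Normc.normcM ler_wpM2l ?normc_ge0//.
by rewrite normc_expC !ReImE mulr0 subr0 expR_Re_le// !ltW.
Qed.

Lemma normc_wp_phi z l : 0 < l ->
  normc (wp_phi z l) <= 2 * normc z * l ^+ 2 * expR (`|Re z| * l).
Proof.
move=> l0; rewrite Normc.normcM normc_real gtr0_norm//.
apply: (le_trans (ler_wpM2l (ltW l0) (normc_expC_sub1 z l0))).
by rewrite le_eqVlt; apply/orP; left; apply/eqP; ring.
Qed.

(** The derivative of [wzeta_phi z] is [- z (e^(z l) - 1)], which is already [O(l)] by
    [normc_expC_sub1]; a second use of the mean value bound gives the other factor [l], and 4 is 2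
    times 2. *)
Lemma normc_wzeta_phi z l : 0 < l ->
  normc (wzeta_phi z l) <= 4 * normc z ^+ 2 * l ^+ 2 * expR (`|Re z| * l).
Proof.
move=> l0; have -> : 4 * normc z ^+ 2 * l ^+ 2 * expR (`|Re z| * l) =
  2 * (normc z * (2 * normc z * l * expR (`|Re z| * l))) * l by ring.
rewrite wzeta_phiE.
apply: (normc_mvt l0 (cderivD (cderivD (cderiv_cst 1) (cderivM (cderiv_cst z) cderiv_id))
  (cderivM (cderiv_cst (-1)) (cderiv_expC z)))).
  rewrite (_ : 0%:C = 0 :> R[i])// mulr0 expC0; ring.
move=> t /andP[t0 tl]; rewrite -normcN.
have -> : - (0 + (0 * t%:C + z * 1) + (0 * expC (z * t%:C) + -1 * (z * expC (z * t%:C)))) =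
  z * (expC (z * t%:C) - 1) by ring.
rewrite Normc.normcM ler_wpM2l ?normc_ge0//.
apply: (le_trans (normc_expC_sub1 z t0)).
have n0 := normc_ge0 z.
apply: ler_pM; rewrite ?expR_ge0 ?mulr_ge0 ?(ltW t0)//.
  by rewrite ler_wpM2l ?mulr_ge0// ltW.
by rewrite ler_expR ler_wpM2l// ltW.
Qed.

Lemma laplace_wp_phi z w : `|Re z| < Re w ->
  integralC D (fun l => wp_phi z l * expC (- w * l%:C)) = wp_term z w.
Proof.
move=> zw.
have w0 : 0 < Re w by apply: le_lt_trans zw.
have wz0 : 0 < Re (w - z) by rewrite cReD cReN subr_gt0 (le_lt_trans (ler_norm _)).
have [i1 E1] := laplace_id wz0; have [i2 E2] := laplace_id w0.
rewrite (@eq_integralC _ _ (fun l => l%:C * expC (- (w - z) * l%:C) +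
   -1 * (l%:C * expC (- w * l%:C)))).
  rewrite integralCD ?integralCZ//; last exact: integrableCZ.
  by rewrite E1 E2 /wp_term !mul1r mulN1r -sqrrN opprB.
move=> l _; have -> : - (w - z) * l%:C = z * l%:C + - w * l%:C by ring.
by rewrite expCD /wp_phi; ring.
Qed.

Lemma laplace_wzeta_phi z w : `|Re z| < Re w ->
  integralC D (fun l => wzeta_phi z l * expC (- w * l%:C)) = wzeta_term z w.
Proof.
move=> zw.
have w0 : 0 < Re w by apply: le_lt_trans zw.
have wz0 : 0 < Re (w - z) by rewrite cReD cReN subr_gt0 (le_lt_trans (ler_norm _)).
have [i1 E1] := laplace_cst w0; have [i2 E2] := laplace_id w0.
have [i3 E3] := laplace_cst wz0.
rewrite (@eq_integralC _ _ (fun l => expC (- w * l%:C) + (z * (l%:C * expC (- w * l%:C)) +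
   -1 * expC (- (w - z) * l%:C)))).
  have i2' := integrableCZ z i2; have i3' := integrableCZ (-1) i3.
  rewrite integralCD ?integralCD ?integralCZ//; last exact: integrableCD.
  rewrite E1 E2 E3 /wzeta_term !mul1r mulN1r -invrN opprB; ring.
move=> l _; have -> : - (w - z) * l%:C = z * l%:C + - w * l%:C by ring.
by rewrite expCD /wzeta_phi; ring.
Qed.

Lemma expC_half z : expC z = expC (z / 2) ^+ 2.
Proof. by rewrite -expC_nat; congr expC; field. Qed.

Lemma sqr_coshC z : coshC (z / 2) ^+ 2 = (expC z + 2 + expC (- z)) / 4.
Proof.
rewrite /coshC !expCN (expC_half z); field.
exact: expC_neq0.
Qed.

Lemma sqr_sinhC z : sinhC (z / 2) ^+ 2 = (expC z - 2 + expC (- z)) / 4.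
Proof.
rewrite /sinhC !expCN (expC_half z); field.
exact: expC_neq0.
Qed.

Lemma cosCE z : cosC z = coshC ('i%C * z). Proof. by []. Qed.

Lemma iC_neq0 : 'i%C != 0 :> R[i].
Proof. by apply/eqP => /(congr1 (fun s : R[i] => Im s)) /= /eqP; rewrite oner_eq0. Qed.

Lemma iC_inv : 'i%C^-1 = - 'i%C :> R[i].
Proof.
apply: (mulfI iC_neq0); rewrite mulfV ?iC_neq0// mulrN -expr2 sqr_i opprK//.
Qed.

Lemma sinCE z : sinC z = - 'i%C * sinhC ('i%C * z).
Proof. by rewrite /sinC /sinhC invfM iC_inv; ring. Qed.

Lemma sqr_cosC z : cosC (z / 2) ^+ 2 = (expC ('i%C * z) + 2 + expC (- ('i%C * z))) / 4.
Proof. by rewrite cosCE mulrA sqr_coshC. Qed.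

Lemma sqr_sinC z : sinC (z / 2) ^+ 2 = - (expC ('i%C * z) - 2 + expC (- ('i%C * z))) / 4.
Proof. by rewrite sinCE mulrA exprMn sqr_sinhC sqrrN sqr_i mulN1r mulNr. Qed.

Lemma cone_kernel_f1 tau l : cone_kernel 1 tau l = 4 * (expC (- l%:C) * f1 tau l).
Proof.
rewrite /cone_kernel /f1 sqr_coshC mulN1r /coshC -expCN.
have -> : expC (- (2 * l%:C)) = expC (- l%:C) ^+ 2 :> R[i].
  by rewrite -expC_nat mulrN.
set q := expC (- l%:C); set a := expC (tau * l%:C); set b := expC (- (tau * l%:C)).
have -> : 1 - 2 * q * ((a + b) / 2) + q ^+ 2 = 1 - q * (a + b) + q ^+ 2 by field.
(* The denominator vanishes at [l = 0]; with its inverse kept as an atom, [field] asks nothing of it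
   and the identity holds for every [l]. *)
set den := (1 - _ + _)^-1.
by rewrite -/den; field.
Qed.

Lemma cone_kernel_f2 tau l :
  cone_kernel (- 'i%C * tau) (- 'i%C) l = 4 * (expC ('i%C * tau * l%:C) * f2 tau l).
Proof.
rewrite /cone_kernel /f2 sqr_cosC /cosC -expCN.
have -> : - (- 'i%C * tau) * l%:C = 'i%C * tau * l%:C :> R[i] by ring.
have -> : expC (2 * 'i%C * tau * l%:C) = expC ('i%C * tau * l%:C) ^+ 2 :> R[i].
  by rewrite -expC_nat !mulrA.
rewrite mulNr opprK.
set q := expC ('i%C * tau * l%:C); set a := expC ('i%C * l%:C); set b := expC (- ('i%C * l%:C)).
have -> : 1 - 2 * q * ((a + b) / 2) + q ^+ 2 = 1 - q * (b + a) + q ^+ 2 by field.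
set den := (1 - _ + _)^-1.
by rewrite -/den; field.
Qed.

(** [phi(z) + phi(-z) = l (e^(z l) - 2 + e^(-z l)) = 4 l sinh^2(z l / 2)], and the cone kernel
    brings another 4. Around [tau] the sign of [i^2] cancels that of [sinh^2(i y) = - sin^2(y)].
    Half of 16, from the doubled weights, is the 8 of the formula. *)
Lemma wp_integrandE z tau l :
  wp_integrand z tau l = 16^-1 * lattice_kernel wp_phi 2 tau z l.
Proof.
rewrite /lattice_kernel /wp_integrand cone_kernel_f1 cone_kernel_f2.
rewrite sqr_sinhC sqr_sinC /wp_phi.
rewrite (_ : -1 * z * l%:C = - (z * l%:C)); last by ring.
rewrite (_ : - 'i%C * z * l%:C = - ('i%C * (z * l%:C))); last by ring.
rewrite -(mulrA 'i%C z) (sqrrN ('i%C : R[i])) sqr_i (sqrrN (1 : R[i])) expr1n.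
set E1 := expC (- l%:C); set E2 := expC ('i%C * tau * l%:C).
set a1 := expC (z * _); set a2 := expC (- (z * _)).
set b1 := expC ('i%C * (z * _)); set b2 := expC (- ('i%C * (z * _))).
by field.
Qed.

(** In degree 1 opposite cones subtract: [phi(z) - phi(-z) = 2 (z l - sinh(z l))], while [i phi(i z)
    - i phi(- i z) = - 2 (z l - sin(z l))], whence the minus sign before [f2]. With the 4 of the
    kernel this is 8, and half of it is the 4 of the formula. *)
Lemma wzeta_integrandE z tau l :
  wzeta_integrand z tau l = 8^-1 * lattice_kernel wzeta_phi 1 tau z l.
Proof.
rewrite /lattice_kernel /wzeta_integrand cone_kernel_f1 cone_kernel_f2.
rewrite sinCE /sinhC !expr1 /wzeta_phi.
rewrite (_ : -1 * z * l%:C = - (z * l%:C)); last by ring.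
rewrite (_ : - 'i%C * z * l%:C = - ('i%C * (z * l%:C))); last by ring.
rewrite -(mulrA 'i%C z).
have ii : 'i%C * 'i%C = -1 :> R[i] by rewrite -expr2 sqr_i.
set E1 := expC (- l%:C); set E2 := expC ('i%C * tau * l%:C).
set a1 := expC (z * _); set a2 := expC (- (z * _)).
set b1 := expC ('i%C * (z * _)); set b2 := expC (- ('i%C * (z * _))).
by field: ii.
Qed.

End Transforms.


(** * The domain, scaling of the lattice, and the conclusion *)

Section Conclusion.
Context {R : realType}.
Implicit Types (x z tau mu nu : R[i]).

(** The four choices of signs on real parts combine into absolute values; the two resulting
    inequalities are the convergence conditions of the cones around the real axis and around
    [tau]. *)
Lemma Ddomain_bounds tau z : Ddomain tau z ->
  `|Re z| + `|Re tau| < 1 /\ `|Im z| < Im tau.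
Proof.
move=> [[]]; rewrite !(cReD, cReN) -[Re 1]/(1 : R) => h1 h2 h3 h4 [].
rewrite !(cImD, cImN) => h5 h6; split; last by rewrite ltr_norml; lra.
by case: (ger0P (Re z)); case: (ger0P (Re tau)); lra.
Qed.

Lemma lattice_scale mu nu (w : R[i]) : mu != 0 ->
  (mu * w \in lattice mu nu `\ 0) = (w \in lattice 1 (nu / mu) `\ 0).
Proof.
move=> mu0; apply/idP/idP; rewrite !inE => -[[m [n h]] w0]; split.
- by exists m, n; apply: (mulfI mu0); rewrite h; field.
- by move=> w0'; apply: w0; rewrite w0' mulr0.
- by exists m, n; rewrite h; field.
- by move=> /eqP; rewrite mulf_eq0 (negbTE mu0) => /eqP.
Qed.

Lemma sumC_scale mu nu z (k : nat) (g : R[i] -> R[i] -> R[i]) : mu != 0 ->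
  (forall c y w, c != 0 -> g y w = c ^+ k * g (c * y) (c * w)) ->
  sumC (lattice mu nu `\ 0) (g (mu * z)) =
  mu ^- k * sumC (lattice 1 (nu / mu) `\ 0) (g z).
Proof.
move=> mu0 gE; apply: (sum_scale _ mu0); first by rewrite invr_eq0 expf_neq0.
move=> w; rewrite lattice_scale//; case: ifP => _; last by rewrite mulr0.
by rewrite (gE mu z w mu0) mulKf// expf_neq0.
Qed.

End Conclusion.

Theorem theorem9 (R : realType) (mu nu tau : R[i])
    (hmu : mu != 0) (htau : tau = nu / mu) (hfund : fundamental_region tau) :
  (forall z : R[i], Ddomain tau z -> z != 0 ->
     [/\ integrableC `]0, +oo[ (wp_integrand z tau),
         wp_inh z tau =
           1 / z ^+ 2 + 8 * integralC `]0, +oo[ (wp_integrand z tau),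
         integrableC `]0, +oo[ (wzeta_integrand z tau)
       & wzeta_inh z tau =
           1 / z + 4 * integralC `]0, +oo[ (wzeta_integrand z tau)]) /\
  (forall x : R[i], ~ lattice mu nu x ->
     wp x mu nu = mu ^- 2 * wp_inh (x / mu) tau /\
     wzeta x mu nu = mu^-1 * wzeta_inh (x / mu) tau) /\
  (forall x z : R[i], z = x / mu -> Ddomain tau z -> z != 0 ->
     wp x mu nu =
       1 / mu ^+ 2 *
         (1 / z ^+ 2 + 8 * integralC `]0, +oo[ (wp_integrand z tau)) /\
     wzeta x mu nu =
       1 / mu *
         (1 / z + 4 * integralC `]0, +oo[ (wzeta_integrand z tau))).
Proof.
have inh z : Ddomain tau z ->
     [/\ integrableC `]0, +oo[ (wp_integrand z tau),
         wp_inh z tau =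
           1 / z ^+ 2 + 8 * integralC `]0, +oo[ (wp_integrand z tau),
         integrableC `]0, +oo[ (wzeta_integrand z tau)
       & wzeta_inh z tau =
           1 / z + 4 * integralC `]0, +oo[ (wzeta_integrand z tau)].
  move=> /Ddomain_bounds[zre zim].
  have [i1 E1] := @lattice_sum R wp_term wp_phi (fun z => 2 * normc z) 2
    wp_term_hom ccont_wp_phi (fun z => mulr_ge0 (ler0n _ _) (normc_ge0 _))
    normc_wp_phi laplace_wp_phi tau z zre zim.
  have [i2 E2] := @lattice_sum R wzeta_term wzeta_phi (fun z => 4 * normc z ^+ 2) 1
    wzeta_term_hom ccont_wzeta_phi
    (fun z => mulr_ge0 (ler0n _ _) (exprn_ge0 _ (normc_ge0 _)))
    normc_wzeta_phi laplace_wzeta_phi tau z zre zim.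
  have wpE : wp_integrand z tau = (fun l => 16^-1 * lattice_kernel wp_phi 2 tau z l).
    by apply/funext => l; exact: wp_integrandE.
  have wzetaE : wzeta_integrand z tau =
      (fun l => 8^-1 * lattice_kernel wzeta_phi 1 tau z l).
    by apply/funext => l; exact: wzeta_integrandE.
  split.
  - by rewrite wpE; exact: integrableCZ.
  - rewrite wpE integralCZ// /wp_inh /wp [sumC _ _]E1; congr (_ + _); by field.
  - by rewrite wzetaE; exact: integrableCZ.
  - rewrite wzetaE integralCZ// /wzeta_inh /wzeta [sumC _ _]E2; congr (_ + _); by field.
have hom x : wp x mu nu = mu ^- 2 * wp_inh (x / mu) tau /\
     wzeta x mu nu = mu^-1 * wzeta_inh (x / mu) tau.
  (* The scaling lemma is stated at points [mu * z]; it is used with [z = x / mu]. *)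
  have xE : mu * (x / mu) = x by rewrite mulrC divfK.
  have := sumC_scale nu (x / mu) hmu (@wp_term_hom R).
  have := sumC_scale nu (x / mu) hmu (@wzeta_term_hom R).
  rewrite xE expr1 -htau => h1 h2; split.
    rewrite /wp [sumC _ _]h2 /wp_inh /wp mulrDr; congr (_ + _).
    by rewrite !mul1r expr_div_n invf_div mulKf ?expf_neq0.
  rewrite /wzeta [sumC _ _]h1 /wzeta_inh /wzeta mulrDr; congr (_ + _).
  by rewrite !mul1r invf_div mulKf.
split; first by move=> z zD _; exact: inh.
split; first by move=> x _; exact: hom.
move=> x z -> zD _; have [h1 h2] := hom x; have [_ e1 _ e2] := inh _ zD.
by rewrite h1 h2 e1 e2 !div1r.
Qed.
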